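(* The following problem can be solved in polynomial time: given a finite disjunction-free default theory $\langle D,W\rangle$, where $W$ is a set of Horn clauses or $W$ is a set of 2-literal clauses, a strict total order $\mathcal{P}$ on $D$, and a literal $\phi$, decide whether $\langle D,W\rangle\models^{BH}_{\mathcal{P}}\phi$.
   Context: $\mathcal{L}$ is the set of formulae of classical propositional logic, $\models$ classical logical consequence, and $Cn(S)=\{\phi\in\mathcal{L}\mid S\models\phi\}$ for $S\subseteq\mathcal{L}$. A default here is a rule $\alpha{:}\beta/\gamma$ with $\alpha,\beta,\gamma\in\mathcal{L}$ (prerequisite $\alpha$, justification $\beta$, conclusion $\gamma$). A default theory is a pair $\langle D,W\rangle$ with $D$ a set of defaults and $W\subseteq\mathcal{L}$. $\delta\mathcal{P}\delta'$ means that $\delta$ has higher priority than $\delta'$. A default theory is disjunction-free if all its defaults have the form $$\frac{a_1\wedge\cdots\wedge a_i : b_1\wedge\cdots\wedge b_n\wedge c_1\wedge\cdots\wedge c_m}{b_1\wedge\cdots\wedge b_n}$$ where all $a_j,b_j,c_j$ are literals (the prerequisite and the part $c_1\wedge\cdots\wedge c_m$ may be empty). A default $\alpha{:}\beta/\gamma$ is active in $E\subseteq\mathcal{L}$ if $E\models\alpha$, $E\not\models\neg\beta$ and $E\not\models\gamma$. For $E\subseteq\mathcal{L}$ define $E_0=W$ and for all $i\ge 0$, $$E_{i+1}=E_i\cup\{\gamma\mid \alpha{:}\beta/\gamma\in D,\ E_i\models\alpha,\ E\not\models\neg\beta,\ \text{no }\delta\in D\text{ with }\delta\,\mathcal{P}\,(\alpha{:}\beta/\gamma)\text{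 is active in }E_i\}.$$ $E$ is a $\mathcal{P}$-preferred$^{BH}$ extension of $\langle D,W\rangle$ if and only if $E=\bigcup_{i\ge 0}Cn(E_i)$. $\langle D,W\rangle\models^{BH}_{\mathcal{P}}\phi$ means that $\phi$ belongs to all $\mathcal{P}$-preferred$^{BH}$ extensions of $\langle D,W\rangle$. *)

(* Defs.v *)
From Corelib Require Import BinNums.
From HB Require Import structures.
From mathcomp Require Import all_boot ssralg poly.
From mathcomp Require Import classical_sets.

Set Implicit Arguments.
Unset Strict Implicit.
Unset Printing Implicit Defensive.

Local Open Scope classical_set_scope.

(** * Propositional logic *)

Inductive formula : Type :=
  | Var of nat
  | Bot
  | Top
  | Neg of formula
  | And of formula & formula
  | Or of formula & formula
  | Imp of formula & formula.

Lemma formula_comparable : comparable formula.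
Proof. by move=> f g; rewrite /decidable; do 2 decide equality. Qed.

HB.instance Definition _ :=
  hasDecEq.Build formula (compareP formula_comparable).

Fixpoint eval (v : nat -> bool) (f : formula) : bool :=
  match f with
  | Var p => v p
  | Bot => false
  | Top => true
  | Neg f => ~~ eval v f
  | And f g => eval v f && eval v g
  | Or f g => eval v f || eval v g
  | Imp f g => eval v f ==> eval v g
  end.

Definition entails (S : set formula) (f : formula) : Prop :=
  forall v : nat -> bool, (forall g, S g -> eval v g) -> eval v f.

Definition Cn (S : set formula) : set formula := [set f | entails S f].

(** * Default logic with priorities *)

Record default : Type :=
  Default { prereq : formula; justif : formula; concl : formula }.

Definition default_tuple (d : default) : formula * formula * formula :=
  (prereq d, justif d, concl d).
Definition tuple_default (t : formula * formula * formula) : default :=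
  Default t.1.1 t.1.2 t.2.

Lemma default_tupleK : cancel default_tuple tuple_default.
Proof. by case. Qed.

HB.instance Definition _ :=
  Equality.copy default (can_type default_tupleK).

Definition active (d : default) (E : set formula) : Prop :=
  [/\ entails E (prereq d),
      ~ entails E (Neg (justif d))
    & ~ entails E (concl d)].

(* [P d d'] means that [d] has higher priority than [d']. *)
Section Extensions.

Variables (D : set default) (W : set formula) (P : default -> default -> Prop).

Fixpoint stage (E : set formula) (i : nat) : set formula :=
  match i with
  | 0 => W
  | j.+1 =>
      stage E j `|`
      [set concl d | d in
        [set d | [/\ D d,
                     entails (stage E j) (prereq d),
                     ~ entails E (Neg (justif d))
                   & ~ (exists d', [/\ D d', P d' d & active d' (stage E j)])]]]
  end.

Definition preferred_extension_BH (E : set formula) : Prop :=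
  E = \bigcup_i Cn (stage E i).

Definition consequence_BH (f : formula) : Prop :=
  forall E : set formula, preferred_extension_BH E -> E f.

End Extensions.

(** * Syntactic restrictions *)

(* The literal [(p, true)] is the atom [p], [(p, false)] is its negation. *)
Definition literal : Type := (nat * bool)%type.

Definition lit_form (l : literal) : formula :=
  if l.2 then Var l.1 else Neg (Var l.1).

(* Iterated connectives associate to the right; the empty conjunction is [Top]
   and the empty disjunction is [Bot]. *)
Fixpoint conjunction (ls : seq literal) : formula :=
  match ls with
  | [::] => Top
  | [:: l] => lit_form l
  | l :: ls' => And (lit_form l) (conjunction ls')
  end.

Fixpoint disjunction (ls : seq literal) : formula :=
  match ls with
  | [::] => Bot
  | [:: l] => lit_form l
  | l :: ls' => Or (lit_form l) (disjunction ls')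
  end.

Definition disjunction_free (d : default) : Prop :=
  exists a b c : seq literal,
    b <> [::] /\
    d = Default (conjunction a) (conjunction (b ++ c)) (conjunction b).

Definition horn_clause (f : formula) : Prop :=
  exists2 ls : seq literal, count snd ls <= 1 & f = disjunction ls.

(* At most two literals, as in 2-CNF. *)
Definition two_literal_clause (f : formula) : Prop :=
  exists2 ls : seq literal, size ls <= 2 & f = disjunction ls.

(** * Instances of the decision problem *)

(* The lists stand for the sets of their members; [priority] is the graph of
   the priority relation. *)
Record instance : Type := Instance {
  defaults : seq default;
  facts : seq formula;
  priority : seq (default * default);
  query : literal }.

Definition higher_priority (x : instance) : rel default :=
  fun d d' => (d, d') \in priority x.

Definition strict_total_order_on (D : seq default) (P : rel default) : Prop :=
  [/\ forall d d', P d d' -> d \in D /\ d' \in D,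
      irreflexive P,
      transitive P
    & {in D &, forall d d', d != d' -> P d d' || P d' d}].

Definition well_formed (x : instance) : Prop :=
  [/\ forall d, d \in defaults x -> disjunction_free d,
      (forall f, f \in facts x -> horn_clause f) \/
      (forall f, f \in facts x -> two_literal_clause f)
    & strict_total_order_on (defaults x) (higher_priority x)].

Definition consequence_instance (x : instance) : Prop :=
  consequence_BH [set` defaults x] [set` facts x] (higher_priority x)
    (lit_form (query x)).

(** * Encoding of instances as words *)

Inductive letter : Type :=
  | Bit of bool
  | EndAtom
  | LBot
  | LTop
  | LNeg
  | LAnd
  | LOr
  | LImp
  | Item
  | EndList.

Definition letter_code (a : letter) : 'I_11 :=
  match a with
  | Bit b => if b then @Ordinal 11 1 isT else @Ordinal 11 0 isT
  | EndAtom => @Ordinal 11 2 isT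
  | LBot => @Ordinal 11 3 isT
  | LTop => @Ordinal 11 4 isT
  | LNeg => @Ordinal 11 5 isT
  | LAnd => @Ordinal 11 6 isT
  | LOr => @Ordinal 11 7 isT
  | LImp => @Ordinal 11 8 isT
  | Item => @Ordinal 11 9 isT
  | EndList => @Ordinal 11 10 isT
  end.

Definition letter_decode (i : 'I_11) : letter :=
  nth EndList
    [:: Bit false; Bit true; EndAtom; LBot; LTop; LNeg; LAnd; LOr; LImp; Item]
    i.

Lemma letter_codeK : cancel letter_code letter_decode.
Proof. by case=> [[]|||||||||]. Qed.

HB.instance Definition _ := Finite.copy letter (can_type letter_codeK).

Fixpoint encode_pos (p : positive) : seq letter :=
  match p with
  | xH => [:: Bit true]
  | xO q => Bit false :: encode_pos q
  | xI q => Bit true :: encode_pos q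
  end.

(* Binary, least significant bit first; 0 is the empty word. *)
Definition encode_nat (n : nat) : seq letter :=
  if bin_of_nat n is Npos p then encode_pos p else [::].

(* Polish notation. *)
Fixpoint encode_form (f : formula) : seq letter :=
  match f with
  | Var p => rcons (encode_nat p) EndAtom
  | Bot => [:: LBot]
  | Top => [:: LTop]
  | Neg f => LNeg :: encode_form f
  | And f g => LAnd :: encode_form f ++ encode_form g
  | Or f g => LOr :: encode_form f ++ encode_form g
  | Imp f g => LImp :: encode_form f ++ encode_form g
  end.

Definition encode_default (d : default) : seq letter :=
  encode_form (prereq d) ++ encode_form (justif d) ++ encode_form (concl d).

Definition encode_pair (dd : default * default) : seq letter :=
  encode_default dd.1 ++ encode_default dd.2.

Definition encode_seq (T : Type) (enc : T -> seq letter) (s : seq T) :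
    seq letter :=
  rcons (flatten [seq Item :: enc t | t <- s]) EndList.

Definition encode_instance (x : instance) : seq letter :=
  encode_seq encode_default (defaults x) ++
  encode_seq encode_form (facts x) ++
  encode_seq encode_pair (priority x) ++
  encode_form (lit_form (query x)).

(** * Deterministic multi-tape Turing machines and polynomial time *)

Inductive move : Type := MoveLeft | MoveRight | Stay.

Section Turing.

Variable A : finType.

(* Tape symbols over the input alphabet [A] and further symbols [B]; [None] is
   the blank. *)
Definition symbol (B : finType) : Type := option (A + B).

(* The machine has [extra_tapes.+1] tapes, the input being on tape [ord0]; it
   halts where [delta] is [None]. *)
Record machine : Type := Machine {
  state : finType;
  work : finType;
  extra_tapes : nat;
  start : state;
  accepting : pred state;
  delta : state -> {ffun 'I_extra_tapes.+1 -> symbol work} ->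
          option (state * {ffun 'I_extra_tapes.+1 -> symbol work * move}) }.

(* A two-way infinite tape: the cells left of the head (nearest first), the
   scanned cell, the cells right of the head; all remaining cells are blank. *)
Record tape (B : finType) : Type :=
  Tape {
    leftof : seq (symbol B);
    scanned : symbol B;
    rightof : seq (symbol B) }.

Definition tape_of_word (B : finType) (w : seq (symbol B)) : tape B :=
  Tape [::] (head None w) (behead w).

Definition write_move (B : finType) (a : symbol B * move) (t : tape B) :
    tape B :=
  let: Tape l _ r := t in
  match a.2 with
  | MoveLeft => Tape (behead l) (head None l) (a.1 :: r)
  | MoveRight => Tape (a.1 :: l) (head None r) (behead r)
  | Stay => Tape l a.1 r
  end.

Section Run.

Variable M : machine.

Definition config : Type :=
  (state M * {ffun 'I_(extra_tapes M).+1 -> tape (work M)})%type.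

Definition initial (w : seq A) : config :=
  (start M,
   [ffun i => if i == ord0 then tape_of_word [seq Some (inl a) | a <- w]
              else tape_of_word [::]]).

Definition transition (c : config) :=
  delta c.1 [ffun i => scanned (c.2 i)].

Definition halted (c : config) : bool := ~~ isSome (transition c).

(* Halted configurations are left unchanged. *)
Definition step (c : config) : config :=
  if transition c is Some (q, a) then
    (q, [ffun i => write_move (a i) (c.2 i)])
  else c.

Definition run (n : nat) (w : seq A) : config := iter n step (initial w).

End Run.

(* One machine decides [Q] on all instances satisfying [valid], within a number
   of steps polynomial in the length of the encoding of the instance. *)
Definition polytime_decidable (T : Type) (encode : T -> seq A)
    (valid Q : T -> Prop) : Prop :=
  exists (M : machine) (p : {poly nat}),
    forall x : T, valid x ->
      let c := run M (horner p (size (encode x))) (encode x) in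
      halted c /\ (accepting c.1 <-> Q x).

End Turing.

(* Main.v *)
From HB Require Import structures.
From Corelib Require Import BinNums.
Require Import Defs.
From mathcomp Require Import all_boot ssralg poly.
From mathcomp Require Import classical_sets.
From mathcomp Require Import boolp zify.

(* At each stage at most one new conclusion can matter, namely that of the active
   default of highest priority, and in an extension this default cannot be
   blocked by its justification. So there is at most one preferred extension,
   the one generated by greedily applying the active default of highest priority,
   and it is preferred iff the justifications of the applied defaults remain
   consistent with the result. All the tests involved ask whether the clauses of
   [W] together with some unit clauses are unsatisfiable; for Horn and 2-literal
   clauses this holds iff for some literal [l], unit propagation refutes both the
   addition of [l] and that of its negation.

   A Turing machine is obtained by compiling programs over a fixed number of
   stacks. Data are binary trees, and the functions on codes of data which such
   programs compute in polynomial time are closed under composition and under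
   folding over a list, provided that the accumulator stays polynomially small. *)

Set Implicit Arguments.
Unset Strict Implicit.
Unset Printing Implicit Defensive.

(** * A stack language compiled to Turing machines *)

(** Conclusions are only compared up to logical equivalence, because a stage may also apply defaults
    that are not active. Their justification is consistent with the extension, hence with the stage,
    so all they lack is a conclusion that is not yet entailed, and they contribute nothing. Among
    the active defaults, totality of the priority leaves only one undominated. If this one were
    blocked by its justification, it would stay active and undominated forever, the stages would no
    longer change up to equivalence, and the extension would be equivalent to a stage with which the
    justification is consistent. When the greedy candidate fails the final consistency test, no
    extension exists and every literal is a consequence. Since conclusions and justifications are
    conjunctions of literals, each set to be tested arises from [W] by adding unit clauses, which
    are both Horn and 2-literal; so the tests never leave the class in which the refutation
    procedure is complete. *)

Inductive reg : Type := RA | RM | RB | RC.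

Record store : Type := Store {
  stA : seq letter; stM : seq letter; stB : seq letter; stC : seq letter }.

Definition content (s : store) (r : reg) : seq letter :=
  match r with RA => stA s | RM => stM s | RB => stB s | RC => stC s end.

Definition put (s : store) (r : reg) (w : seq letter) : store :=
  let: Store a m b c := s in
  match r with
  | RA => Store w m b c
  | RM => Store a w b c
  | RB => Store a m w c
  | RC => Store a m b w
  end.

Definition top (s : store) (r : reg) : option letter := ohead (content s r).

Inductive cmd : Type :=
  | Skip
  | Push of reg & letter
  | Pop of reg
  | Seq of cmd & cmd
  | If of reg & pred (option letter) & cmd & cmd
  | While of reg & pred (option letter) & cmd.

(* The number bounds the steps taken by the compiled machine. *)
Inductive exec : cmd -> store -> nat -> store -> Prop :=
  | ExecSkip s : exec Skip s 0 s
  | ExecPush s r a : exec (Push r a) s 2 (put s r (a :: content s r))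
  | ExecPop s r : exec (Pop r) s 1 (put s r (behead (content s r)))
  | ExecSeq c1 c2 s1 s2 s3 m n : exec c1 s1 m s2 -> exec c2 s2 n s3 ->
      exec (Seq c1 c2) s1 (m + n) s3
  | ExecThen r (p : pred (option letter)) c1 c2 s1 s2 n : p (top s1 r) -> exec c1 s1 n s2 ->
      exec (If r p c1 c2) s1 n.+2 s2
  | ExecElse r (p : pred (option letter)) c1 c2 s1 s2 n : ~~ p (top s1 r) -> exec c2 s1 n s2 ->
      exec (If r p c1 c2) s1 n.+1 s2
  | ExecLoop r (p : pred (option letter)) c s1 s2 s3 m n : p (top s1 r) -> exec c s1 m s2 ->
      exec (While r p c) s2 n s3 -> exec (While r p c) s1 (m + n).+2 s3
  | ExecExit r (p : pred (option letter)) c s : ~~ p (top s r) -> exec (While r p c) s 1 s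
  | ExecWeaken c s1 s2 m n : exec c s1 m s2 -> m <= n -> exec c s1 n s2.

Definition store_size (s : store) : nat :=
  size (stA s) + size (stM s) + size (stB s) + size (stC s).

(** Only a push enlarges a register, by one letter at the price of two steps. Time bounds thus yield
    bounds on the size of results. *)
Lemma exec_size c s n s' :
  exec c s n s' -> store_size s' <= store_size s + n.
Proof.
rewrite /store_size; elim=> {c s n s'} //=; try by move=> *; lia.
- by case=> a m b c [] l /=; lia.
- by case=> [[|? a] [|? m] [|? b] [|? c]] [] /=; lia.
Qed.

Notation tsymbol := (symbol letter void).

Inductive instr : Type :=
  | Act of reg & (tsymbol -> tsymbol) & move
  | Branch of reg & pred (option letter) & nat.

Definition letter_of (x : tsymbol) : option letter :=
  if x is Some (inl a) then Some a else None.

(* Jump targets are absolute: the code is placed at address [i]. *)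
Fixpoint compile (i : nat) (c : cmd) : seq instr :=
  match c with
  | Skip => [::]
  | Push r a => [:: Act r id MoveLeft; Act r (fun=> Some (inl a)) Stay]
  | Pop r => [:: Act r id MoveRight]
  | Seq c1 c2 =>
      let k1 := compile i c1 in k1 ++ compile (i + size k1) c2
  | If r p c1 c2 =>
      let k1 := compile i.+1 c1 in
      let j := i.+1 + (size k1).+1 in
      let k2 := compile j c2 in
      Branch r (predC p) j :: k1 ++ Branch r predT (j + size k2) :: k2
  | While r p c =>
      let k := compile i.+1 c in
      Branch r (predC p) (i.+1 + (size k).+1) :: k ++ [:: Branch r predT i]
  end.

Definition reg_index (r : reg) : 'I_4 :=
  match r with
  | RA => @Ordinal 4 0 isT
  | RM => @Ordinal 4 1 isT
  | RB => @Ordinal 4 2 isT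
  | RC => @Ordinal 4 3 isT
  end.

(** * Turing machines running compiled code *)

Section Machine.

Variables (code : seq instr) (accept : nat).

(** A crude bound that leaves room for all addresses, for the halting address [size code] and for
    [accept]. *)
Definition code_state : finType := 'I_(size code + accept).+1.

Definition perform (i : instr) (q : code_state)
    (x : {ffun 'I_4 -> tsymbol}) :
    code_state * {ffun 'I_4 -> tsymbol * move} :=
  match i with
  | Act r f d =>
      (inord q.+1,
       [ffun k => if k == reg_index r then (f (x k), d) else (x k, Stay)])
  | Branch r p j =>
      (inord (if p (letter_of (x (reg_index r))) then j else q.+1),
       [ffun k => (x k, Stay)])
  end.

Definition code_delta (q : code_state) (x : {ffun 'I_4 -> tsymbol}) :=
  if q < size code then
    Some (perform (nth (Branch RA predT 0) code q) q x)
  else None.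

Definition code_machine : machine letter :=
  @Machine letter code_state void 3 ord0 (fun q => val q == accept) code_delta.

(** The cells left of the head are unconstrained: pops leave garbage there, and a push moves left
    and then overwrites. The [k] blanks account for cells already visited beyond the end of the
    word. *)
Definition holds_word (t : tape letter void) (w : seq letter) : Prop :=
  exists k, scanned t :: rightof t = [seq Some (inl a) | a <- w] ++ nseq k None.

Lemma holds_word_scanned t w : holds_word t w -> letter_of (scanned t) = ohead w.
Proof. by case: t w => l x r [|a w] [] [|k] //= [-> _]. Qed.

Lemma holds_word_pop t w x : holds_word t w ->
  holds_word (write_move (x, MoveRight) t) (behead w).
Proof.
case: t => l y r [k /= E]; case: w E => [|a w] /=.
  case: k => //= k [_ ->]; case: k => [|k]; first by exists 1.
  by exists k.+1.
case=> _ ->; case: w => [|b w] /=; last by exists k.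
by case: k => [|k]; [exists 1 | exists k.+1].
Qed.

Lemma holds_word_push t w a : holds_word t w ->
  holds_word (write_move (Some (inl a), Stay)
                (write_move (scanned t, MoveLeft) t)) (a :: w).
Proof. by case: t => l y r [k /= E]; exists k => /=; rewrite E. Qed.

Lemma write_stay (t : tape letter void) : write_move (scanned t, Stay) t = t.
Proof. by case: t. Qed.

Definition pc (x : config code_machine) : nat := nat_of_ord (x.1 : code_state).

Definition represents (x : config code_machine) (i : nat) (s : store) : Prop :=
  pc x = i /\ forall r, holds_word (x.2 (reg_index r)) (content s r).

Lemma pc_inord q t : q <= size code + accept -> pc (inord q : code_state, t) = q.
Proof. by move=> q_le; rewrite /pc /= inordK. Qed.

Lemma step_act x r f d :
  pc x < size code -> nth (Branch RA predT 0) code (pc x) = Act r f d ->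
  step x =
  (inord (pc x).+1 : code_state,
   [ffun k => if k == reg_index r then write_move (f (scanned (x.2 k)), d) (x.2 k)
              else x.2 k]) :> config code_machine.
Proof.
move=> xs xE; rewrite /step /transition /= /code_delta xs xE /=; congr (_, _).
apply/ffunP=> k; rewrite !ffunE; case: ifP => // _.
exact: write_stay.
Qed.

Lemma step_branch x r p j :
  pc x < size code -> nth (Branch RA predT 0) code (pc x) = Branch r p j ->
  step x =
  (inord (if p (letter_of (scanned (x.2 (reg_index r)))) then j else (pc x).+1)
     : code_state, x.2) :> config code_machine.
Proof.
case: x => q t xs xE; rewrite /step /transition /= /code_delta xs xE /=.
rewrite ffunE; congr (_, _).
by apply/ffunP=> k; rewrite !ffunE write_stay.
Qed.

Lemma content_put s r r' w :
  content (put s r w) r' = if reg_index r' == reg_index r then w else content s r'.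
Proof. by case: s r r' => a b c d [] []. Qed.

Definition placed (i : nat) (k : seq instr) : Prop :=
  exists pre post, code = pre ++ k ++ post /\ size pre = i.

Lemma placed_cat i k1 k2 :
  placed i (k1 ++ k2) -> placed i k1 /\ placed (i + size k1) k2.
Proof.
case=> pre [post] [codeE <-]; split; first by exists pre, (k2 ++ post); rewrite codeE !catA.
by exists (pre ++ k1), post; rewrite codeE !catA size_cat.
Qed.

Lemma placed_cons i x k : placed i (x :: k) ->
  [/\ nth (Branch RA predT 0) code i = x, i < size code & placed i.+1 k].
Proof.
rewrite -cat1s => /placed_cat [[pre [post [codeE <-]]]]; rewrite addn1.
split=> //; first by rewrite codeE nth_cat ltnn subnn.
by rewrite codeE !size_cat /= addnS ltnS leq_addr.
Qed.

Lemma placed_size i k : placed i k -> i + size k <= size code.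
Proof. by case=> pre [post [-> <-]]; rewrite !size_cat; lia. Qed.

Lemma branch_correct x i s r p j :
  nth (Branch RA predT 0) code i = Branch r p j -> i < size code ->
  j <= size code -> represents x i s ->
  represents (step x) (if p (top s r) then j else i.+1) s.
Proof.
move=> iE i_lt j_le [xi xs]; rewrite (@step_branch x r p j) ?xi //.
split=> //=; rewrite (holds_word_scanned (xs r)) pc_inord //.
by case: ifP => _; lia.
Qed.

Lemma act_correct x i s r f d w :
  nth (Branch RA predT 0) code i = Act r f d -> i < size code ->
  represents x i s ->
  (holds_word (x.2 (reg_index r)) (content s r) ->
   holds_word (write_move (f (scanned (x.2 (reg_index r))), d) (x.2 (reg_index r))) w) ->
  represents (step x) i.+1 (put s r w).
Proof.
move=> iE i_lt [xi xs] fw; rewrite (@step_act x r f d) ?xi //.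
split; first by rewrite pc_inord //; lia.
move=> r'; rewrite content_put /= !ffunE; case: eqP => [->|//].
exact: fw.
Qed.

(** The induction is on the execution and not on the command: the last premise of a loop concerns
    the same [While], hence code at the same address. The charges in [exec] count the tests and the
    jumps of the compiled code. *)
Lemma compile_correct c s n s' : exec c s n s' ->
  forall i x, placed i (compile i c) -> represents x i s ->
  exists2 m, m <= n &
    represents (iter m (@step _ code_machine) x) (i + size (compile i c)) s'.
Proof.
elim=> {c s n s'}.
- by move=> s i x _ xs; exists 0; rewrite ?addn0.
- move=> s r a i x /= /placed_cons [iE i_lt /placed_cons [jE j_lt _]] [xi xs].
  exists 2 => //=; rewrite (@step_act x r id MoveLeft) ?xi //.
  have vE t : pc (inord i.+1 : code_state, t) = i.+1 by rewrite pc_inord //; lia.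
  rewrite (@step_act _ r (fun=> Some (inl a)) Stay) ?vE //.
  split; first by rewrite pc_inord ?addn2 //; lia.
  move=> r'; rewrite content_put /= !ffunE; case: eqP => [->|//].
  exact: holds_word_push.
- move=> s r i x /= /placed_cons [iE i_lt _] xs; exists 1 => //=.
  by rewrite addn1; apply: act_correct iE i_lt xs _; apply: holds_word_pop.
- move=> c1 c2 s1 s2 s3 m n _ IH1 _ IH2 i x /= /placed_cat [p1 p2] xs.
  have [m1 le1 r1] := IH1 _ _ p1 xs; have [m2 le2 r2] := IH2 _ _ p2 r1.
  by exists (m2 + m1); [lia | rewrite iterD size_cat addnA].
- move=> r p c1 c2 s1 s2 n ps _ IH i x /=.
  set j := i.+1 + _; set k1 := compile _ c1; set k2 := compile _ c2.
  move=> /[dup] /placed_size /=; rewrite size_cat /= => le_code.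
  case/placed_cons=> iE i_lt /placed_cat [p1 /placed_cons [eE e_lt p2]] xs.
  have le_j : j <= size code by rewrite /j -/k1; lia.
  have := branch_correct iE i_lt le_j xs; rewrite /= ps /= => r0.
  have [m1 le1 r1] := IH _ _ p1 r0.
  exists m1.+2; first by lia.
  have le_e : j + size k2 <= size code by rewrite /j -/k1; lia.
  have := branch_correct eE e_lt le_e r1; rewrite -iterS -iterSr.
  by congr (represents _ _ _); rewrite /j -/k1; lia.
- move=> r p c1 c2 s1 s2 n ps _ IH i x /=.
  set j := i.+1 + _; set k1 := compile _ c1; set k2 := compile _ c2.
  move=> /[dup] /placed_size /=; rewrite size_cat /= => le_code.
  case/placed_cons=> iE i_lt /placed_cat [p1 /placed_cons [eE e_lt p2]] xs.
  have le_j : j <= size code by rewrite /j -/k1; lia.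
  have := branch_correct iE i_lt le_j xs; rewrite /= ps /= => r0.
  have jE : (i.+1 + size k1).+1 = j by rewrite /j -/k1 addnS.
  rewrite jE in p2; have [m1 le1 r1] := IH _ _ p2 r0.
  exists m1.+1; first by lia.
  rewrite iterSr; move: r1; congr (represents _ _ _).
  by rewrite -/k2 /j -/k1; lia.
- move=> r p c s1 s2 s3 m n ps _ IH1 _ IH2 i x /=.
  set j := i.+1 + _; set k := compile _ c => pW.
  move: (pW); move=> /[dup] /placed_size /=; rewrite size_cat /= => le_code.
  case/placed_cons=> iE i_lt /placed_cat [p1 /placed_cons [eE e_lt _]] xs.
  have le_j : j <= size code by rewrite /j -/k; lia.
  have := branch_correct iE i_lt le_j xs; rewrite /= ps /= => r0.
  have [m1 le1 r1] := IH1 _ _ p1 r0.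
  have := branch_correct eE e_lt (ltnW i_lt) r1; rewrite /= => r2.
  have [m2 le2 r3] := IH2 _ _ pW r2.
  exists (m2 + m1.+2); first by lia.
  by move: r3; rewrite iterD (iterS m1.+1) (iterSr m1) /= size_cat.
- move=> r p c s ps i x /=.
  set j := i.+1 + _; set k := compile _ c.
  move=> /[dup] /placed_size /=; rewrite size_cat /= => le_code.
  case/placed_cons=> iE i_lt _ xs.
  have le_j : j <= size code by rewrite /j -/k; lia.
  have := branch_correct iE i_lt le_j xs; rewrite /= ps /= => r0.
  exists 1 => //=; move: r0; congr (represents _ _ _).
  by rewrite /j -/k; lia.
- move=> c s1 s2 m n _ IH le_mn i x ic xs.
  by have [k le_k r] := IH _ _ ic xs; exists k => //; lia.
Qed.

End Machine.



Lemma iter_halted (M : machine letter) (x : config M) n :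
  halted x -> iter n (@step _ M) x = x.
Proof.
rewrite /halted => hx; elim: n => //= n ->.
by rewrite /step; case: transition hx.
Qed.

Section Decide.

Variables (c : cmd) (p : pred (option letter)).

(* The machine halts just behind the final test when it fails, and one address
   further when it succeeds. *)
Definition decider : machine letter :=
  let k := compile 0 c in
  code_machine (rcons k (Branch RM p (size k).+2)) (size k).+2.

(** The strict inequality pays for the final test; all further steps are idle because the machine
    has halted. *)
Lemma decider_correct w n s N :
  exec c (Store w [::] [::] [::]) n s -> n < N ->
  let x := run decider N w in
  halted x /\ (accepting x.1 <-> p (top s RM)).
Proof.
set k := compile 0 c; set code := rcons k (Branch RM p (size k).+2) => ws n_lt.
have codeE : code = [::] ++ k ++ [:: Branch RM p (size k).+2].
  by rewrite /code -cats1.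
have sE : size code = (size k).+1 by rewrite size_rcons.
have r0 : represents (initial decider w : config (code_machine code (size k).+2))
            0 (Store w [::] [::] [::]).
  split=> // r; rewrite /= ffunE; case: r => /=.
  - case: w {ws} => [|a w]; first by exists 1.
    by exists 0; rewrite cats0.
  - by exists 1.
  - by exists 1.
  - by exists 1.
have pk : placed code 0 (compile 0 c).
  by exists [::], [:: Branch RM p (size k).+2].
have [m le_m r1] := compile_correct ws pk r0.
have kE : nth (Branch RA predT 0) code (size k) = Branch RM p (size k).+2.
  by rewrite /code nth_rcons ltnn eqxx.
have [xk xs] := r1; rewrite add0n -/k in xk r1.
set x1 := iter m _ _ in xk xs r1.
have k_lt : pc x1 < size code by rewrite xk sE.
have := @step_branch _ _ x1 RM p (size k).+2 k_lt.
rewrite xk => /(_ kE); rewrite (holds_word_scanned (xs RM)) -/(top s RM).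
set q := if _ then _ else _ => x2E.
have qE : pc (step x1) = q.
  by rewrite x2E pc_inord // /q; case: ifP => _; lia.
have q_ge : (q < size code) = false by rewrite sE /q; case: ifP => _; lia.
have h2 : halted (step x1).
  rewrite /halted /transition /= /code_delta.
  by rewrite -[nat_of_ord _]/(pc (step x1)) qE q_ge.
have -> : run decider N w = step x1.
  rewrite /run -(subnK (_ : m.+1 <= N)); last by lia.
  by rewrite iterD iterS; apply: iter_halted.
split=> //=; rewrite -[nat_of_ord _]/(pc (step x1)) qE /q.
by case: (p _); rewrite ?eqxx // -/k ltn_eqF.
Qed.

End Decide.

(** * Trees on a value stack *)

Inductive tree : Type := Leaf | Node of tree & tree.

Fixpoint bits (t : tree) : seq bool :=
  if t is Node a b then true :: bits a ++ bits b else [:: false].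

Lemma bits_cat_inj t t' v v' : bits t ++ v = bits t' ++ v' -> t = t' /\ v = v'.
Proof.
elim: t t' v v' => [|a IHa b IHb] [|a' b'] //= v v'; first by case.
by case; rewrite -!catA => /IHa [-> /IHb [-> ->]].
Qed.

Lemma bits_inj : injective bits.
Proof.
move=> t t' E; have := @bits_cat_inj t t' [::] [::].
by rewrite E => /(_ erefl) [].
Qed.

Lemma tree_comparable : comparable tree.
Proof. by move=> t t'; rewrite /decidable; decide equality. Qed.

HB.instance Definition _ := hasDecEq.Build tree (compareP tree_comparable).

Notation bword := (map Bit).
Infix ";;" := Seq (at level 61, right associativity).

Definition has_letter : pred (option letter) := isSome.
Definition is_bit (b : bool) : pred (option letter) := pred1 (Some (Bit b)).

Definition transfer (r r' : reg) : cmd :=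
  If r (is_bit true) (Pop r ;; Push r' (Bit true)) (Pop r ;; Push r' (Bit false)).

Definition pour (r r' : reg) : cmd := While r has_letter (transfer r r').

Lemma exec_transfer r r' s b w : reg_index r != reg_index r' ->
  content s r = Bit b :: w ->
  exec (transfer r r') s 5 (put (put s r w) r' (Bit b :: content s r')).
Proof.
move=> neq sE.
have -> : put (put s r w) r' (Bit b :: content s r') =
    put (put s r (behead (content s r))) r' (Bit b :: content (put s r (behead (content s r))) r').
  by rewrite sE content_put eq_sym (negbTE neq).
case: b sE => sE.
  apply: ExecThen; first by rewrite /top sE.
  exact: (@ExecSeq _ _ _ _ _ 1 2 (ExecPop _ _) (ExecPush _ _ _)).
apply: ExecWeaken (_ : 4 <= 5) => //.
apply: ExecElse; first by rewrite /top sE.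
exact: (@ExecSeq _ _ _ _ _ 1 2 (ExecPop _ _) (ExecPush _ _ _)).
Qed.

Lemma put_put_put s r r' w1 w2 w3 w4 : reg_index r != reg_index r' ->
  put (put (put (put s r w1) r' w2) r w3) r' w4 = put (put s r w3) r' w4.
Proof. by case: s r r' => a m b c [] []. Qed.

Lemma put_content s r : put s r (content s r) = s.
Proof. by case: s r => a m b c []. Qed.

Lemma exec_pour r r' s v : reg_index r != reg_index r' -> content s r = bword v ->
  exec (pour r r') s (7 * size v + 1)
    (put (put s r [::]) r' (bword (rev v) ++ content s r')).
Proof.
move=> neq; elim: v s => [|b v IH] s sE.
  have -> : put (put s r [::]) r' (bword (rev [::]) ++ content s r') = s.
    have {}sE : content s r = [::] := sE.
    by rewrite /= -{1}sE !put_content.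
  by apply: ExecExit; rewrite /top sE.
have e1 := exec_transfer neq sE.
have := IH (put (put s r (bword v)) r' (Bit b :: content s r')).
rewrite !content_put !eqxx (negbTE neq) => /(_ erefl).
rewrite put_put_put // => e2.
apply: (@ExecWeaken _ _ _ (5 + (7 * size v + 1)).+2); last by rewrite /=; lia.
rewrite rev_cons map_rcons cat_rcons.
by apply: ExecLoop e1 e2; rewrite /top sE.
Qed.

(** The length of [RC] is the number of subtrees still to be read: a node bit replaces one by two, a
    leaf bit removes one. Started with one letter in [RC], the loop reads exactly one tree. *)
Definition scan (r : reg) : cmd :=
  While RC has_letter
    (If RM (is_bit true)
       (Pop RM ;; Push r (Bit true) ;; Push RC (Bit true))
       (Pop RM ;; Push r (Bit false) ;; Pop RC)).

Definition move_tree (r : reg) : cmd := Push RC (Bit true) ;; scan r.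

(** [RA] and [RB], the registers that [scan] does not itself need as source or counter. *)
Definition scratch (r : reg) : bool := (reg_index r == 0 :> nat) || (reg_index r == 2 :> nat).

(** Stated with a continuation: the premise is the rest of the loop after [t] has been read, with
    one letter less in [RC]. In this form the induction hypotheses for two subtrees chain. *)
Lemma exec_scan r t a v b c x m f : scratch r ->
  exec (scan r)
    (put (Store a (bword v) b c) r
       (bword (rev (bits t)) ++ content (Store a [::] b c) r)) m f ->
  exec (scan r) (Store a (bword (bits t ++ v)) b (x :: c))
    (9 * size (bits t) + m) f.
Proof.
move=> sr; elim: t a v b c x m f => [|t IHt t' IHt'] a v b c x m f E.
  apply: (@ExecWeaken _ _ _ (5 + m).+2); last by rewrite /=; lia.
  apply: ExecLoop E => //; apply: ExecElse => //.
  apply: (@ExecSeq _ _ _ _ _ 1 3 (ExecPop _ _)).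
  by case: r sr => // _; apply: (@ExecSeq _ _ _ _ _ 2 1 (ExecPush _ _ _) (ExecPop _ _)).
apply: (@ExecWeaken _ _ _ (7 + (9 * size (bits t) + (9 * size (bits t') + m))).+2); last first.
  by rewrite /= size_cat; lia.
apply: (@ExecLoop _ _ _ _ (put (Store a (bword (bits t ++ bits t' ++ v)) b [:: Bit true, x & c]) r
           (Bit true :: content (Store a [::] b c) r))) => //.
  apply: ExecThen => //=; rewrite -catA.
  apply: (@ExecSeq _ _ _ _ _ 1 4 (ExecPop _ _)).
  by case: r sr {E IHt IHt'} => // _;
    apply: (@ExecSeq _ _ _ _ _ 2 2 (ExecPush _ _ _) (ExecPush _ _ _)).
case: r sr IHt IHt' E => // _ IHt IHt' E.
  apply: (IHt); apply: (IHt'); move: E => /=.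
  by rewrite rev_cons rev_cat map_rcons cat_rcons map_cat -catA.
apply: (IHt); apply: (IHt'); move: E => /=.
by rewrite rev_cons rev_cat map_rcons cat_rcons map_cat -catA.
Qed.

Lemma exec_move_tree r t a v b : scratch r ->
  exec (move_tree r) (Store a (bword (bits t ++ v)) b [::])
    (9 * size (bits t) + 3)
    (put (Store a (bword v) b [::]) r
       (bword (rev (bits t)) ++ content (Store a [::] b [::]) r)).
Proof.
move=> sr; apply: (@ExecWeaken _ _ _ (2 + (9 * size (bits t) + 1))); last lia.
apply: (ExecSeq (ExecPush _ _ _)); apply: exec_scan => //.
by apply: ExecExit; case: r sr.
Qed.

Definition clear (r : reg) : cmd := While r has_letter (Pop r).

Lemma exec_clear r s : exec (clear r) s (3 * size (content s r) + 1) (put s r [::]).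
Proof.
move E: (content s r) => w; elim: w s E => [|x w IH] s sE.
  by rewrite -{2}sE put_content; apply: ExecExit; rewrite /top sE.
apply: (@ExecWeaken _ _ _ (1 + (3 * size w + 1)).+2); last by rewrite /=; lia.
apply: ExecLoop (ExecPop _ _) _; first by rewrite /top sE.
have -> : put s r [::] = put (put s r (behead (content s r))) r [::].
  by case: s r {sE IH} => a m b c [].
by apply: IH; rewrite content_put eqxx sE.
Qed.

(* During the computation proper, [RM] holds a stack of trees, which can be
   concatenated because their codes are self-delimiting; the other registers are
   scratch space, [RC] serving as a unary counter. *)
Definition stack (v : seq bool) : store := Store [::] (bword v) [::] [::].

Definition drop_tree : cmd := move_tree RA ;; clear RA.

Lemma exec_drop_tree t v :
  exec drop_tree (stack (bits t ++ v)) (12 * size (bits t) + 4) (stack v).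
Proof.
apply: (@ExecWeaken _ _ _ ((9 * size (bits t) + 3) + (3 * size (bits t) + 1))); last lia.
apply: ExecSeq (@exec_move_tree RA t [::] v [::] isT) _.
rewrite /= cats0; have := exec_clear RA (Store (bword (rev (bits t))) (bword v) [::] [::]).
by rewrite /= size_map size_rev.
Qed.

Definition transfer_twice : cmd :=
  If RA (is_bit true)
    (Pop RA ;; Push RM (Bit true) ;; Push RB (Bit true))
    (Pop RA ;; Push RM (Bit false) ;; Push RB (Bit false)).

(** Every pour reverses, so the second copy has to travel from [RB] through [RA] to reach [RM] in
    the right order. *)
Definition dup_tree : cmd :=
  move_tree RA ;; While RA has_letter transfer_twice ;; pour RB RA ;; pour RA RM.

Lemma exec_pour_twice u v w :
  exec (While RA has_letter transfer_twice)
    (Store (bword u) (bword v) (bword w) [::]) (9 * size u + 1)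
    (Store [::] (bword (rev u ++ v)) (bword (rev u ++ w)) [::]).
Proof.
elim: u v w => [|b u IH] v w; first by apply: ExecExit.
apply: (@ExecWeaken _ _ _ (7 + (9 * size u + 1)).+2); last by rewrite /=; lia.
rewrite rev_cons !cat_rcons.
apply: ExecLoop (IH (b :: v) (b :: w)) => //; case: b.
  apply: ExecThen => //; apply: (@ExecSeq _ _ _ _ _ 1 4 (ExecPop _ _)).
  exact: (ExecSeq (ExecPush _ _ _) (ExecPush _ _ _)).
apply: (@ExecWeaken _ _ _ 6) => //.
apply: ExecElse => //; apply: (@ExecSeq _ _ _ _ _ 1 4 (ExecPop _ _)).
exact: (ExecSeq (ExecPush _ _ _) (ExecPush _ _ _)).
Qed.

Lemma exec_dup_tree t v :
  exec dup_tree (stack (bits t ++ v)) (32 * size (bits t) + 6)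
    (stack (bits t ++ bits t ++ v)).
Proof.
set n := size (bits t).
apply: (@ExecWeaken _ _ _ ((9 * n + 3) + ((9 * n + 1) + ((7 * n + 1) + (7 * n + 1))))); last lia.
apply: ExecSeq (@exec_move_tree RA t [::] v [::] isT) _.
rewrite /= cats0.
have := exec_pour_twice (rev (bits t)) v [::].
rewrite size_rev revK cats0 => e; apply: ExecSeq e _.
set s := Store _ _ _ _; apply: ExecSeq (@exec_pour RB RA s (bits t) isT erefl) _.
rewrite /= cats0.
have := @exec_pour RA RM (Store (bword (rev (bits t))) (bword (bits t ++ v)) [::] [::])
  (rev (bits t)) isT erefl.
by rewrite /= size_rev revK -map_cat.
Qed.

Definition swap_trees : cmd :=
  move_tree RA ;; move_tree RB ;; pour RA RM ;; pour RB RM.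

Lemma exec_swap_trees t t' v :
  exec swap_trees (stack (bits t ++ bits t' ++ v))
    (16 * (size (bits t) + size (bits t')) + 8) (stack (bits t' ++ bits t ++ v)).
Proof.
apply: (@ExecWeaken _ _ _ ((9 * size (bits t) + 3) + ((9 * size (bits t') + 3) +
  ((7 * size (bits t) + 1) + (7 * size (bits t') + 1))))); last lia.
apply: ExecSeq (@exec_move_tree RA t [::] (bits t' ++ v) [::] isT) _.
rewrite /= cats0.
apply: ExecSeq (@exec_move_tree RB t' (bword (rev (bits t))) v [::] isT) _.
rewrite /= cats0.
set s := Store _ _ _ _.
have := @exec_pour RA RM s (rev (bits t)) isT erefl.
rewrite /= size_rev revK -map_cat => e; apply: ExecSeq e _.
set s' := Store _ _ _ _.
have := @exec_pour RB RM s' (rev (bits t')) isT erefl.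
by rewrite /= size_rev revK -map_cat.
Qed.

Fixpoint push_bits (v : seq bool) : cmd :=
  if v is b :: v' then push_bits v' ;; Push RM (Bit b) else Skip.

Lemma exec_push_bits u a v b c :
  exec (push_bits u) (Store a (bword v) b c) (2 * size u)
    (Store a (bword (u ++ v)) b c).
Proof.
elim: u => [|x u IH]; first exact: ExecSkip.
rewrite [size _]/= mulnS addnC; apply: ExecSeq IH _.
exact: (ExecPush (Store a (bword (u ++ v)) b c) RM (Bit x)).
Qed.

Definition bool_tree (b : bool) : tree := if b then Node Leaf Leaf else Leaf.

Definition mismatch : cmd := clear RA ;; clear RB ;; Push RC (Bit true).

(** The outcome is read off the registers: a letter in [RC] reports a mismatch, a rest in [RB] a
    proper prefix. *)
Definition compare_words : cmd :=
  While RA has_letter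
    (If RA (is_bit true)
       (If RB (is_bit true) (Pop RA ;; Pop RB) mismatch)
       (If RB (is_bit false) (Pop RA ;; Pop RB) mismatch)).

Lemma exec_mismatch u m v :
  exec mismatch (Store (bword u) m (bword v) [::])
    (3 * (size u + size v) + 4) (Store [::] m [::] [:: Bit true]).
Proof.
apply: (@ExecWeaken _ _ _ ((3 * size u + 1) + ((3 * size v + 1) + 2))); last lia.
have := exec_clear RA (Store (bword u) m (bword v) [::]).
rewrite /= size_map => e; apply: ExecSeq e _.
have := exec_clear RB (Store [::] m (bword v) [::]).
rewrite /= size_map => e; apply: ExecSeq e _.
exact: ExecPush.
Qed.

Lemma exec_compare_words u m v :
  exec compare_words (Store (bword u) m (bword v) [::])
    (8 * (size u + size v) + 11)
    (if prefix u v then Store [::] m (bword (drop (size u) v)) [::]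
     else Store [::] m [::] [:: Bit true]).
Proof.
elim: u v => [|b u IH] v.
  rewrite prefix0s drop0; apply: (@ExecWeaken _ _ _ 1); last by lia.
  exact: ExecExit.
have [E|neq] := eqVneq (ohead v) (Some b).
  case: v E => [|_ v] //= [->]; rewrite eqxx /=.
  apply: (@ExecWeaken _ _ _ (6 + (8 * (size u + size v) + 11)).+2); last by lia.
  apply: ExecLoop (IH v) => //.
  apply: (@ExecWeaken _ _ _ 6) => //; case: b.
    do 2!apply: ExecThen => //.
    exact: (ExecSeq (ExecPop (Store (bword (_ :: u)) _ (bword (_ :: v)) _) RA) (ExecPop _ _)).
  apply: (@ExecWeaken _ _ _ 5) => //.
  apply: ExecElse => //; apply: ExecThen => //.
  exact: (ExecSeq (ExecPop (Store (bword (_ :: u)) _ (bword (_ :: v)) _) RA) (ExecPop _ _)).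
have -> : prefix (b :: u) v = false.
  by case: v neq => //= b' v; case: (eqVneq b b') => //= ->; rewrite eqxx.
rewrite /=; pose s' := Store [::] m [::] [:: Bit true].
apply: (@ExecWeaken _ _ _ ((3 * (size (b :: u) + size v) + 4).+3 + 1).+2); last by rewrite /=; lia.
apply: (@ExecLoop _ _ _ _ s') => //; last by apply: ExecExit.
have e := exec_mismatch (b :: u) m v.
have neqB : (ohead (bword v) == Some (Bit b)) = false.
  by case: v neq {e} => // b' v; apply: contraNF => /eqP [->].
case: b e neqB {neq} => e neqB.
  by apply: ExecThen => //; apply: ExecElse; rewrite // /is_bit /top /= neqB.
apply: (@ExecWeaken _ _ _ (3 * (size (false :: u) + size v) + 4).+2); last by lia.
by apply: ExecElse => //; apply: ExecElse; rewrite // /is_bit /top /= neqB.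
Qed.

(** The words compared are reversed codes, and these are not prefix-free: every code ends with a
    leaf bit, so that of [Leaf] begins every reversed code. Hence the test for a rest in [RB]. *)
Definition eq_trees : cmd :=
  move_tree RA ;; move_tree RB ;; compare_words ;;
  If RB has_letter (clear RB ;; Push RC (Bit true)) Skip ;;
  If RC has_letter (Pop RC ;; Push RM (Bit false))
    (push_bits (bits (bool_tree true))).

Lemma exec_eq_trees t t' v :
  exec eq_trees (stack (bits t ++ bits t' ++ v))
    (20 * (size (bits t) + size (bits t')) + 50)
    (stack (bits (bool_tree (t == t')) ++ v)).
Proof.
set n := size (bits t); set n' := size (bits t').
apply: (@ExecWeaken _ _ _ ((9 * n + 3) + ((9 * n' + 3) +
  ((8 * (n + n') + 11) + ((3 * n' + 5) + 20))))); last lia.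
apply: ExecSeq (@exec_move_tree RA t [::] (bits t' ++ v) [::] isT) _.
rewrite /= cats0.
apply: ExecSeq (@exec_move_tree RB t' (bword (rev (bits t))) v [::] isT) _.
rewrite /= cats0.
have e := exec_compare_words (rev (bits t)) (bword v) (rev (bits t')).
rewrite !size_rev in e; apply: ExecSeq e _.
set u := drop _ _.
pose s := if t == t' then stack v else Store [::] (bword v) [::] [:: Bit true].
apply: (@ExecSeq _ _ _ s).
  have [E|neq] := eqVneq t t'.
    rewrite /u -E prefix_refl /s E eqxx -(size_rev (bits t')) drop_size.
    apply: (@ExecWeaken _ _ _ 1); last lia.
    by apply: ExecElse => //; apply: ExecSkip.
  rewrite /s (negbTE neq); case: ifPn => [/prefixP [w E]|_]; last first.
    apply: (@ExecWeaken _ _ _ 1); last lia.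
    by apply: ExecElse => //; apply: ExecSkip.
  have uE : u = w by rewrite /u E -(size_rev (bits t)) drop_size_cat.
  rewrite uE; apply: (@ExecWeaken _ _ _ ((3 * size w + 1) + 2).+2); last first.
    have : size w <= n' by rewrite /n' -(size_rev (bits t')) E size_cat leq_addl.
    by clear; lia.
  case: w E {uE} => [|b w] E.
    by case/eqP: neq; apply/bits_inj/esym/(can_inj revK); rewrite E cats0.
  apply: ExecThen => //.
  have := exec_clear RB (Store [::] (bword v) (bword (b :: w)) [::]).
  rewrite /= size_map => e; apply: ExecSeq e _.
  exact: ExecPush.
rewrite /s; case: eqP => _.
  apply: (@ExecWeaken _ _ _ 7) => //; apply: ExecElse => //.
  exact: (@exec_push_bits [:: true; false; false]).
apply: (@ExecWeaken _ _ _ 5) => //; apply: ExecThen => //.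
exact: (ExecSeq (ExecPop _ _) (ExecPush _ _ _)).
Qed.

(** * Functions computable in polynomial time *)

(** A single shape of bound makes the closure properties a matter of exponents. The base is at least
    2, so constants are absorbed by raising the exponent. *)
Definition poly_bounded (f : nat -> nat) : Prop :=
  exists k, forall n, f n <= (n + 2) ^ k.

Lemma poly_bounded_pow k : poly_bounded (fun n => (n + 2) ^ k).
Proof. by exists k. Qed.

Lemma poly_bounded_id : poly_bounded id.
Proof. by exists 1 => n; rewrite expn1 leq_addr. Qed.

Lemma poly_bounded_const c : poly_bounded (fun=> c).
Proof.
exists c => n; apply: (@leq_trans (2 ^ c)); first by apply/ltnW/ltn_expl.
by case: c => // c; rewrite leq_exp2r // leq_addl.
Qed.

Lemma poly_bounded_mul f g :
  poly_bounded f -> poly_bounded g -> poly_bounded (fun n => f n * g n).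
Proof.
by case=> [j fj] [k gk]; exists (j + k) => n; rewrite expnD leq_mul.
Qed.

Lemma poly_bounded_add f g :
  poly_bounded f -> poly_bounded g -> poly_bounded (fun n => f n + g n).
Proof.
(* For positive a and b, a + b <= 2ab, and the additional factor n + 2 absorbs the 2. *)
case=> [j fj] [k gk]; exists (j + k).+1 => n.
have fgn := leq_add (fj n) (gk n); apply: leq_trans fgn _.
rewrite expnS expnD.
have: 0 < (n + 2) ^ j by rewrite expn_gt0 addn2.
have: 0 < (n + 2) ^ k by rewrite expn_gt0 addn2.
by nia.
Qed.

Lemma poly_bounded_comp f g :
  poly_bounded f -> poly_bounded g -> poly_bounded (fun n => f (g n)).
Proof.
(* The argument of the outer power satisfies (n + 2)^k + 2 <= (n + 2)^(k + 2). *)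
move=> [j fj] [k gk]; exists ((k + 2) * j) => n.
apply: leq_trans (fj _) _; rewrite expnM.
case: j {fj} => // j; rewrite leq_exp2r // expnD.
have := gk n; have: 0 < (n + 2) ^ k by rewrite expn_gt0 addn2.
by nia.
Qed.

Ltac poly_bounded_tac :=
  repeat first
    [ exact: poly_bounded_id
    | exact: poly_bounded_const
    | exact: poly_bounded_pow
    | apply: poly_bounded_add
    | apply: poly_bounded_mul
    | match goal with
      | |- poly_bounded (fun n => (@?f n + 2) ^ ?k) =>
          apply: (poly_bounded_comp (poly_bounded_pow k) (g := f))
      end ].

Definition tsize (t : tree) : nat := size (bits t).

Lemma bits_node_cat t t' v :
  bits (Node t t') ++ v = true :: bits t ++ bits t' ++ v.
Proof. by rewrite /= catA. Qed.

Lemma tsize_node t t' : tsize (Node t t') = (tsize t + tsize t').+1.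
Proof. by rewrite /tsize /= size_cat. Qed.

Definition tree_hd (t : tree) : tree := if t is Node a _ then a else Leaf.
Definition tree_tl (t : tree) : tree := if t is Node _ b then b else Leaf.

(* [a x] and [b x] are the representations of the argument and of the result
   for the input [x]. *)
Definition computes (X : Type) (a b : X -> tree) : Prop :=
  exists c k, forall x v,
    exec c (stack (bits (a x) ++ v)) ((tsize (a x) + 2) ^ k)
      (stack (bits (b x) ++ v)).

Section Computes.

Variables (X : Type) (a : X -> tree).

Lemma computes_intro b f c : poly_bounded f ->
  (forall x v, exec c (stack (bits (a x) ++ v)) (f (tsize (a x)))
     (stack (bits (b x) ++ v))) ->
  computes a b.
Proof.
by case=> k fk cf; exists c, k => x v; apply: ExecWeaken (cf x v) (fk _).
Qed.

Lemma computes_ext b b' : b =1 b' -> computes a b -> computes a b'.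
Proof.
move=> bb' [c [k cE]]; exists c, k => x v.
by rewrite -bb'; apply: cE.
Qed.

(** A result is no larger than the input plus the time spent. This lets the time of a second program
    be bounded in terms of the input of the first. *)
Lemma computes_size b : computes a b ->
  exists k, forall x, tsize (b x) <= (tsize (a x) + 2) ^ k.
Proof.
case=> c [k cE].
have [j jE] : poly_bounded (fun n => n + (n + 2) ^ k) by poly_bounded_tac.
exists j => x; apply: leq_trans (jE _).
by have := exec_size (cE x [::]); rewrite /store_size /= !size_map !cats0 !addn0.
Qed.

Lemma computes_comp b d : computes a b -> computes b d -> computes a d.
Proof.
move=> ab [c2 [k2 c2E]]; have [k kE] := computes_size ab; case: ab => c1 [k1 c1E].
apply: (@computes_intro d (fun n => (n + 2) ^ k1 + ((n + 2) ^ k + 2) ^ k2) (c1 ;; c2)).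
  by poly_bounded_tac.
move=> x v; apply: ExecSeq (c1E x v) _; apply: ExecWeaken (c2E x v) _.
by case: k2 {c2E} => // k2; rewrite leq_exp2r // leq_add2r.
Qed.

Lemma computes_id : computes a a.
Proof.
apply: (@computes_intro a (fun=> 0) Skip) => [|x v]; first by poly_bounded_tac.
exact: ExecSkip.
Qed.

Lemma computes_const t : computes a (fun=> t).
Proof.
apply: (@computes_intro _ (fun n => (12 * n + 4) + 2 * tsize t) (drop_tree ;; push_bits (bits t))).
  by poly_bounded_tac.
by move=> x v; apply: ExecSeq (exec_drop_tree _ _) (exec_push_bits _ _ _ _ _).
Qed.

(** [d] is computed first, so that its result ends up below that of [b], as the code of a node
    demands. *)
Lemma computes_node b d : computes a b -> computes a d ->
  computes a (fun x => Node (b x) (d x)).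
Proof.
move=> [c1 [k1 c1E]] ad; have [k kE] := computes_size ad; case: ad => c2 [k2 c2E].
apply: (@computes_intro _
  (fun n => (32 * n + 6) + ((n + 2) ^ k2 + (16 * ((n + 2) ^ k + n) + 8 + ((n + 2) ^ k1 + 2))))
  (dup_tree ;; c2 ;; swap_trees ;; c1 ;; Push RM (Bit true))).
  by poly_bounded_tac.
move=> x v; apply: ExecSeq (exec_dup_tree _ _) _; apply: ExecSeq (c2E x _) _.
apply: ExecSeq (_ : exec _ _ _ (stack (bits (a x) ++ bits (d x) ++ v))) _.
  apply: ExecWeaken (exec_swap_trees _ _ _) _.
  by rewrite leq_add2r leq_mul2l /= leq_add2r; apply: kE.
apply: ExecSeq (c1E x _) _; rewrite /= -catA.
exact: ExecPush.
Qed.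

Lemma computes_hd : computes a (fun x => tree_hd (a x)).
Proof.
apply: (@computes_intro _ (fun n => 40 * n + 20)
  (If RM (is_bit true) (Pop RM ;; move_tree RB ;; drop_tree ;; pour RB RM) Skip)).
  by poly_bounded_tac.
move=> x v; case: (a x) => [|t t'].
  by apply: ExecWeaken (ExecElse _ _ (ExecSkip _)) _.
apply: (@ExecWeaken _ _ _ (1 + ((9 * tsize t + 3) + ((12 * tsize t' + 4) + (7 * tsize t + 1)))).+2).
  apply: ExecThen => //; rewrite /= -catA; apply: ExecSeq (ExecPop _ _) _ => /=.
  apply: ExecSeq (@exec_move_tree RB t [::] (bits t' ++ v) [::] isT) _.
  rewrite /= cats0.
  apply: (@ExecSeq _ _ _ (Store [::] (bword v) (bword (rev (bits t))) [::])).
    apply: (@ExecWeaken _ _ _ ((9 * tsize t' + 3) + (3 * tsize t' + 1))); last by lia.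
    apply: ExecSeq (@exec_move_tree RA t' [::] v _ isT) _.
    rewrite /= cats0; set s := Store _ _ _ _.
    by have := exec_clear RA s; rewrite /= size_map size_rev.
  set s := Store _ _ _ _; have := @exec_pour RB RM s (rev (bits t)) isT erefl.
  by rewrite size_rev revK /= -map_cat.
by rewrite tsize_node; lia.
Qed.

Lemma computes_tl : computes a (fun x => tree_tl (a x)).
Proof.
apply: (@computes_intro _ (fun n => 12 * n + 20)
  (If RM (is_bit true) (Pop RM ;; drop_tree) Skip)).
  by poly_bounded_tac.
move=> x v; case: (a x) => [|t t'].
  by apply: ExecWeaken (ExecElse _ _ (ExecSkip _)) _.
apply: (@ExecWeaken _ _ _ (1 + (12 * tsize t + 4)).+2).
  apply: ExecThen => //; rewrite /= -catA; apply: ExecSeq (ExecPop _ _) _ => /=.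
  exact: exec_drop_tree.
by rewrite tsize_node; lia.
Qed.

Lemma computes_if b f g : computes a (fun x => bool_tree (b x)) ->
  computes a f -> computes a g -> computes a (fun x => if b x then f x else g x).
Proof.
move=> [c [k cE]] [c1 [k1 c1E]] [c2 [k2 c2E]].
apply: (@computes_intro _
  (fun n => (32 * n + 6) + ((n + 2) ^ k + (42 + (n + 2) ^ k1 + (n + 2) ^ k2)))
  (dup_tree ;; c ;; If RM (is_bit true) (drop_tree ;; c1) (drop_tree ;; c2))).
  by poly_bounded_tac.
move=> x v; apply: ExecSeq (exec_dup_tree _ _) _; apply: ExecSeq (cE x _) _.
case: (b x).
  apply: (@ExecWeaken _ _ _ (40 + (tsize (a x) + 2) ^ k1).+2); last lia.
  apply: ExecThen => //.
  exact: ExecSeq (exec_drop_tree (bool_tree true) _) (c1E x v).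
apply: (@ExecWeaken _ _ _ (16 + (tsize (a x) + 2) ^ k2).+1); last lia.
apply: ExecElse => //.
exact: ExecSeq (exec_drop_tree (bool_tree false) _) (c2E x v).
Qed.

End Computes.

Lemma computes_eq X (a b d : X -> tree) : computes a b -> computes a d ->
  computes a (fun x => bool_tree (b x == d x)).
Proof.
move=> ab ad; apply: computes_comp (computes_node ab ad) _.
apply: (@computes_intro _ _ _ (fun n => 20 * n + 60) (Pop RM ;; eq_trees)).
  by poly_bounded_tac.
move=> x v.
apply: (@ExecWeaken _ _ _ (1 + (20 * (tsize (b x) + tsize (d x)) + 50))).
  apply: ExecSeq (ExecPop _ _) _; rewrite /= -catA; exact: exec_eq_trees.
by rewrite tsize_node; lia.
Qed.

(** * Encodable types and polynomial-time functions between them *)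

Class encodable (T : Type) :=
  Encodable { code : T -> tree; code_inj : injective code }.

Lemma bool_tree_inj : injective bool_tree.
Proof. by do 2!case. Qed.

#[export] Instance bool_encodable : encodable bool := Encodable bool_tree_inj.

Definition pair_tree T U `{encodable T} `{encodable U} (p : T * U) : tree :=
  Node (code p.1) (code p.2).

Lemma pair_tree_inj T U `{encodable T} `{encodable U} : injective (@pair_tree T U _ _).
Proof.
by case=> [x y] [x' y'] [] => /(@code_inj T) -> /(@code_inj U) ->.
Qed.

#[export] Instance pair_encodable T U `{encodable T} `{encodable U} :
  encodable (T * U) := Encodable (@pair_tree_inj T U _ _).

Fixpoint seq_tree T `{encodable T} (s : seq T) : tree :=
  if s is x :: s' then Node (code x) (seq_tree s') else Leaf.

Lemma seq_tree_inj T `{encodable T} : injective (@seq_tree T _).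
Proof. by elim=> [|x s IH] [|y s'] //= [] /(@code_inj T) -> /IH ->. Qed.

#[export] Instance seq_encodable T `{encodable T} : encodable (seq T) :=
  Encodable (@seq_tree_inj T _).

Definition csize T `{encodable T} (x : T) : nat := tsize (code x).

Definition polytime X Y `{encodable X} `{encodable Y} (f : X -> Y) : Prop :=
  computes (@code X _) (fun x => code (f x)).

Section Polytime.

Context X `{encodable X}.

Lemma polytime_ext Y `{encodable Y} (f g : X -> Y) :
  f =1 g -> polytime f -> polytime g.
Proof. by move=> fg; apply: computes_ext => x; rewrite fg. Qed.

Lemma polytime_size Y `{encodable Y} (f : X -> Y) : polytime f ->
  exists k, forall x, csize (f x) <= (csize x + 2) ^ k.
Proof. exact: computes_size. Qed.

Lemma polytime_id : polytime (fun x : X => x).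
Proof. exact: computes_id. Qed.

Lemma polytime_const Y `{encodable Y} (y : Y) : polytime (fun _ : X => y).
Proof. exact: computes_const. Qed.

Lemma polytime_comp Y Z `{encodable Y} `{encodable Z} (g : Y -> Z) (f : X -> Y) :
  polytime g -> polytime f -> polytime (fun x => g (f x)).
Proof.
move=> [c [k cE]] pf; apply: computes_comp pf _.
by exists c, k => x v; apply: cE.
Qed.

Lemma polytime_pair Y Z `{encodable Y} `{encodable Z} (f : X -> Y) (g : X -> Z) :
  polytime f -> polytime g -> polytime (fun x => (f x, g x)).
Proof. exact: computes_node. Qed.

Lemma polytime_cons Y `{encodable Y} (f : X -> Y) (g : X -> seq Y) :
  polytime f -> polytime g -> polytime (fun x => f x :: g x).
Proof. exact: computes_node. Qed.

Lemma polytime_fst Y Z `{encodable Y} `{encodable Z} (f : X -> Y * Z) :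
  polytime f -> polytime (fun x => (f x).1).
Proof. by move=> pf; apply: computes_comp pf (computes_hd _). Qed.

Lemma polytime_snd Y Z `{encodable Y} `{encodable Z} (f : X -> Y * Z) :
  polytime f -> polytime (fun x => (f x).2).
Proof. by move=> pf; apply: computes_comp pf (computes_tl _). Qed.

Lemma polytime_if Y `{encodable Y} (b : X -> bool) (f g : X -> Y) :
  polytime b -> polytime f -> polytime g ->
  polytime (fun x => if b x then f x else g x).
Proof.
move=> pb pf pg; apply: computes_ext (computes_if pb pf pg) => x.
by case: (b x).
Qed.

Lemma polytime_eq (T : eqType) `{encodable T} (f g : X -> T) :
  polytime f -> polytime g -> polytime (fun x => f x == g x).
Proof.
move=> pf pg; apply: computes_ext (computes_eq pf pg) => x.
by rewrite (inj_eq code_inj).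
Qed.

Lemma polytime_behead Y `{encodable Y} (f : X -> seq Y) :
  polytime f -> polytime (fun x => behead (f x)).
Proof.
move=> pf; apply: computes_ext (computes_comp pf (computes_tl _)) => x.
by case: (f x).
Qed.

Lemma polytime_nilp Y `{encodable Y} (f : X -> seq Y) :
  polytime f -> polytime (fun x => nilp (f x)).
Proof.
move=> pf; apply: computes_ext (computes_eq pf (computes_const _ Leaf)) => x.
by case: (f x) => [|y s] /=; [rewrite eqxx | case: eqP].
Qed.

Lemma polytime_head Y `{encodable Y} y (f : X -> seq Y) :
  polytime f -> polytime (fun x => head y (f x)).
Proof.
move=> pf; apply: computes_ext (computes_if (polytime_nilp pf)
  (computes_const _ (code y)) (computes_comp pf (computes_hd _))) => x.
by case: (f x).
Qed.

Lemma polytime_negb (f : X -> bool) :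
  polytime f -> polytime (fun x => ~~ f x).
Proof.
move=> pf; apply: polytime_ext
  (polytime_if pf (polytime_const false) (polytime_const true)) => x.
by case: (f x).
Qed.

Lemma polytime_andb (f g : X -> bool) :
  polytime f -> polytime g -> polytime (fun x => f x && g x).
Proof.
move=> pf pg; apply: polytime_ext (polytime_if pf pg (polytime_const false)) => x.
by case: (f x).
Qed.

Lemma polytime_orb (f g : X -> bool) :
  polytime f -> polytime g -> polytime (fun x => f x || g x).
Proof.
move=> pf pg; apply: polytime_ext (polytime_if pf (polytime_const true) pg) => x.
by case: (f x).
Qed.

End Polytime.

Lemma csize_pair T U `{encodable T} `{encodable U} (x : T) (y : U) :
  csize (x, y) = (csize x + csize y).+1.
Proof. exact: tsize_node. Qed.

Lemma csize_cons T `{encodable T} (x : T) s : csize (x :: s) = (csize x + csize s).+1.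
Proof. exact: tsize_node. Qed.

Lemma csize_cat T `{encodable T} (s1 s2 : seq T) :
  (csize (s1 ++ s2)).+1 = csize s1 + csize s2.
Proof. by elim: s1 => // x s IH; rewrite /= !csize_cons -addnS IH; lia. Qed.

Lemma csize_catrev T `{encodable T} (s1 s2 : seq T) :
  (csize (catrev s1 s2)).+1 = csize s1 + csize s2.
Proof.
by elim: s1 s2 => // x s IH s2; rewrite /= IH !csize_cons; lia.
Qed.

Lemma size_le_csize T `{encodable T} (s : seq T) : size s < csize s.
Proof. by elim: s => // x s IH; rewrite csize_cons /=; lia. Qed.

(** * Folding over a list *)

Section Fold.

Context X E S `{eX : encodable X} `{eE : encodable E} `{eS : encodable S}.
Variables (h : X * S * E -> S) (l : X -> seq E) (i : X -> S).

Let fold x s r := foldl (fun s e => h (x, s, e)) s r.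

(** Between two rounds the node bit in front of the triple of list, accumulator and input is
    missing, so the top letter tells whether the list is empty; pushing the bit turns the triple
    into an argument for [c]. In [n + 4], two units count the nodes of the triple and two come from
    the shape of the bounds. *)
Lemma exec_fold c k x v r s n :
  (forall (y : X * S * E * seq E) v,
     exec c (stack (bits (Node (code (y.1.2 :: y.2)) (Node (code y.1.1.2) (code y.1.1.1))) ++ v))
       ((tsize (Node (code (y.1.2 :: y.2)) (Node (code y.1.1.2) (code y.1.1.1))) + 2) ^ k)
       (stack (bits (Node (code y.2) (Node (code (h y.1)) (code y.1.1.1))) ++ v))) ->
  (forall j, csize x + csize (fold x s (take j r)) + csize r <= n) ->
  exec (While RM (is_bit true) (Push RM (Bit true) ;; c ;; Pop RM))
    (stack (bits (code r) ++ bits (Node (code s) (code x)) ++ v))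
    (size r * ((n + 4) ^ k + 5) + 1)
    (stack (bits Leaf ++ bits (Node (code (fold x s r)) (code x)) ++ v)).
Proof.
move=> cE; elim: r s => [|e r IH] s le_n; first by apply: ExecExit.
apply: (@ExecWeaken _ _ _
  ((2 + ((n + 4) ^ k + 1)) + (size r * ((n + 4) ^ k + 5) + 1)).+2); last first.
  by rewrite [size (_ :: _)]/= mulSn; lia.
apply: ExecLoop (IH (h (x, s, e)) _) => //; last first.
  by move=> j; have := le_n j.+1; rewrite /= csize_cons; lia.
pose t := Node (@code _ (@seq_encodable E eE) r)
  (Node (@code S eS (h (x, s, e))) (@code X eX x)).
apply: ExecSeq (ExecPush _ _ _) _.
apply: ExecSeq (_ : exec _ _ _ (stack (bits t ++ v))) _; last first.
  by rewrite /t {1}bits_node_cat; apply: ExecPop.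
have e1 := cE (x, s, e, r) v; rewrite bits_node_cat in e1.
apply: ExecWeaken e1 _ => /=.
rewrite !tsize_node; have := le_n 0; rewrite take0 csize_cons /= /csize /= => le0.
by case: k {cE IH} => // k; rewrite leq_exp2r //=; lia.
Qed.

Lemma polytime_foldl : polytime h -> polytime l -> polytime i ->
  (exists k, forall x j, csize (fold x (i x) (take j (l x))) <= (csize x + 2) ^ k) ->
  polytime (fun x => fold x (i x) (l x)).
Proof.
move=> ph pl pi [k0 k0E].
have [k1 k1E] := polytime_size pl; have [k2 k2E] := polytime_size pi.
have [c0 [j0 c0E]] : computes (@code X _)
    (fun x => Node (code (l x)) (Node (code (i x)) (code x))).
  by apply: computes_node pl _; apply: computes_node pi _; apply: computes_id.
set A := fun y : X * S * E * seq E =>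
  Node (code (y.1.2 :: y.2)) (Node (code y.1.1.2) (code y.1.1.1)).
have [c [k cE]] : computes A
    (fun y => Node (code y.2) (Node (code (h y.1)) (code y.1.1.1))).
  have pe : computes A (fun y => code y.1.2).
    exact: computes_comp (computes_hd A) (computes_hd _).
  have pr : computes A (fun y => code y.2).
    exact: computes_comp (computes_hd A) (computes_tl _).
  have ps : computes A (fun y => code y.1.1.2).
    exact: computes_comp (computes_tl A) (computes_hd _).
  have px : computes A (fun y => code y.1.1.1).
    exact: computes_comp (computes_tl A) (computes_tl _).
  apply: (computes_node pr); apply: (fun b => computes_node b px).
  have pxse : computes A (fun y => code y.1).
    by apply: computes_ext (computes_node (computes_node px ps) pe) => -[[[x s] e] r].
  apply: computes_comp pxse _; case: ph => c [k cE].
  by exists c, k => y v; apply: cE.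
have [c' [k' c'E]] : computes (fun y : S * X => Node Leaf (Node (code y.1) (code y.2)))
    (fun y => code y.1).
  exact: computes_comp (computes_tl _) (computes_hd _).
(* [N] bounds the input, any intermediate accumulator and the list together. In [f], the 2 and the 3
   added to it count the nodes, and finally the empty list, around these data. *)
pose N n := n + (n + 2) ^ k0 + (n + 2) ^ k1.
pose f n := (n + 2) ^ j0 +
  (1 + (((n + 2) ^ k1 * ((N n + 2 + 2) ^ k + 5) + 1) + (2 + (N n + 3 + 2) ^ k'))).
apply: (@computes_intro _ _ _ f (c0 ;; Pop RM ;;
    While RM (is_bit true) (Push RM (Bit true) ;; c ;; Pop RM) ;; Push RM (Bit true) ;; c')).
  by rewrite /f /N; poly_bounded_tac.
move=> x v; have e0 := c0E x v; rewrite bits_node_cat in e0.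
apply: ExecSeq e0 _.
apply: ExecSeq (ExecPop _ _) _.
set n := tsize (code x).
have le_N j : csize x + csize (fold x (i x) (take j (l x))) + csize (l x) <= N n.
  by have := k0E x j; have := k1E x; rewrite /N /n /csize; lia.
apply: ExecSeq (_ : exec _ _ _
  (stack (bits Leaf ++ bits (Node (code (fold x (i x) (l x))) (code x)) ++ v))) _.
  apply: ExecWeaken (exec_fold v cE le_N) _.
  rewrite leq_add2r -[N n + 2 + 2]addnA leq_mul2r; apply/orP; right.
  by apply: ltnW; apply: leq_trans (size_le_csize _) (k1E x).
apply: ExecSeq (ExecPush _ _ _) _.
have e1 := c'E (fold x (i x) (l x), x) v; rewrite bits_node_cat in e1.
apply: ExecWeaken e1 _ => /=.
have := le_N (size (l x)); rewrite take_size /= !tsize_node /csize.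
have -> : tsize Leaf = 1 by [].
by case: (k') => // m le; rewrite leq_exp2r //; lia.
Qed.

(** If the growth in one round is bounded independently of the accumulator, the total growth is at
    most the length of the list times that bound. An arbitrary polynomial growth per round could
    instead compound. *)
Lemma polytime_foldl_incr k : polytime h -> polytime l -> polytime i ->
  (forall x s e, csize (h (x, s, e)) <= csize s + (csize x + csize e + 2) ^ k) ->
  polytime (fun x => fold x (i x) (l x)).
Proof.
move=> ph pl pi hk; apply: polytime_foldl => //.
have [k1 k1E] := polytime_size pl; have [k2 k2E] := polytime_size pi.
have [j jE] : poly_bounded (fun n => (n + 2) ^ k2 + (n + 2) ^ k1 * ((n + (n + 2) ^ k1) + 2) ^ k).
  by poly_bounded_tac.
exists j => x m; apply: leq_trans (jE _).
have le_l := k1E x; have le_i := k2E x.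
apply: (@leq_trans (csize (i x) + size (l x) * (csize x + csize (l x) + 2) ^ k)); last first.
  apply: leq_add => //; apply: leq_mul.
    by apply: ltnW; apply: leq_trans (size_le_csize _) _.
  by case: (k) => // k'; rewrite leq_exp2r // leq_add2r leq_add2l.
elim: (l x) m (i x) {le_l le_i} => [|e r IH] [|m] s; rewrite ?leq_addr //=.
apply: leq_trans (IH _ _) _; rewrite mulSn addnA leq_add //.
  apply: leq_trans (hk _ _ _) _; rewrite leq_add2l; case: (k) => // k'.
  by rewrite leq_exp2r // csize_cons; lia.
by rewrite leq_mul2l; apply/orP; right; case: (k) => // k'; rewrite leq_exp2r // csize_cons; lia.
Qed.

End Fold.

(** * List operations in polynomial time *)

Lemma polytime_catrev X Y `{encodable X} `{encodable Y} (f g : X -> seq Y) :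
  polytime f -> polytime g -> polytime (fun x => catrev (f x) (g x)).
Proof.
move=> pf pg; apply: (@polytime_ext _ _ _ _
  (fun x => foldl (fun s e => e :: s) (g x) (f x))).
  by move=> x /=; elim: (f x) (g x) => //= y s IH t; rewrite IH.
apply: (@polytime_foldl_incr _ _ _ _ _ _ (fun y => y.2 :: y.1.2) _ _ 1) => //.
  apply: polytime_cons; first exact/polytime_snd/polytime_id.
  exact/polytime_snd/polytime_fst/polytime_id.
by move=> x s e /=; rewrite csize_cons expn1; lia.
Qed.

Lemma polytime_rev X Y `{encodable X} `{encodable Y} (f : X -> seq Y) :
  polytime f -> polytime (fun x => rev (f x)).
Proof. by move=> pf; apply: polytime_catrev pf (polytime_const _). Qed.

Lemma polytime_cat X Y `{encodable X} `{encodable Y} (f g : X -> seq Y) :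
  polytime f -> polytime g -> polytime (fun x => f x ++ g x).
Proof.
move=> pf pg; apply: polytime_ext (polytime_catrev (polytime_rev pf) pg) => x.
by rewrite catrevE revK.
Qed.

Lemma polytime_has X E `{encodable X} `{encodable E} (p : X * E -> bool) (l : X -> seq E) :
  polytime p -> polytime l -> polytime (fun x => has (fun e => p (x, e)) (l x)).
Proof.
move=> pp pl; apply: (@polytime_ext _ _ _ _
  (fun x => foldl (fun b e => b || p (x, e)) false (l x))).
  move=> x /=; rewrite -[RHS]orFb; elim: (l x) false => [|e s IH] b /=; first by rewrite orbF.
  by rewrite IH orbA.
apply: (@polytime_foldl_incr _ _ _ _ _ _
  (fun y => y.1.2 || p (y.1.1, y.2)) _ _ 2) => //; last 1 first.
- move=> x b e /=; apply: (@leq_trans 3); first by rewrite /csize; case: (_ || _).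
  by rewrite -mulnn; nia.
- apply: polytime_orb; first exact/polytime_snd/polytime_fst/polytime_id.
  apply: (polytime_comp pp); apply: polytime_pair; last exact/polytime_snd/polytime_id.
  exact/polytime_fst/polytime_fst/polytime_id.
- exact: polytime_const.
Qed.

Lemma polytime_all X E `{encodable X} `{encodable E} (p : X * E -> bool) (l : X -> seq E) :
  polytime p -> polytime l -> polytime (fun x => all (fun e => p (x, e)) (l x)).
Proof.
move=> pp pl.
have := polytime_negb (polytime_has (polytime_negb pp) pl); apply: polytime_ext => x.
by rewrite -all_predC; apply: eq_all => e /=; rewrite negbK.
Qed.

Lemma polytime_mem X (E : eqType) `{encodable X} `{encodable E} (f : X -> E) (l : X -> seq E) :
  polytime f -> polytime l -> polytime (fun x => f x \in l x).
Proof.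
move=> pf pl; apply: (@polytime_ext _ _ _ _
  (fun x => has (fun e => e == f x) (l x))).
  by move=> x /=; rewrite has_pred1.
apply: (polytime_has (p := fun y => y.2 == f y.1)) pl.
apply: polytime_eq; first exact/polytime_snd/polytime_id.
exact/(polytime_comp pf)/polytime_fst/polytime_id.
Qed.

Lemma polytime_flatmap X E Y `{encodable X} `{encodable E} `{encodable Y}
    (h : X * E -> seq Y) (l : X -> seq E) :
  polytime h -> polytime l ->
  polytime (fun x => flatten [seq h (x, e) | e <- l x]).
Proof.
move=> ph pl; apply: (@polytime_ext _ _ _ _
  (fun x => rev (foldl (fun s e => catrev (h (x, e)) s) [::] (l x)))).
  move=> x /=; rewrite -[RHS]/(rev [::] ++ _); elim: (l x) [::] => [|e r IH] s.
    by rewrite cats0.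
  by rewrite /= IH catrevE rev_cat revK -catA.
have [k kE] := polytime_size ph.
(* The exponent doubles because a pair is one larger than its components together, and n + 3 <= (n +
   2)^2. *)
apply: polytime_rev; apply: (@polytime_foldl_incr _ _ _ _ _ _
  (fun y => catrev (h (y.1.1, y.2)) y.1.2) _ _ (k * 2)) => //.
- apply: polytime_catrev; last exact/polytime_snd/polytime_fst/polytime_id.
  apply: (polytime_comp ph); apply: polytime_pair; last exact/polytime_snd/polytime_id.
  exact/polytime_fst/polytime_fst/polytime_id.
- exact: polytime_const.
move=> x s e /=; have := kE (x, e); rewrite csize_pair.
set n := csize x + csize e => le1.
suff le2: (n.+1 + 2) ^ k <= (n + 2) ^ (k * 2).
  rewrite -(leq_add2r 1) addn1 csize_catrev addnC; lia.
by rewrite mulnC expnM; case: (k) => // m; rewrite leq_exp2r // -mulnn; nia.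
Qed.

Lemma polytime_map X E Y `{encodable X} `{encodable E} `{encodable Y}
    (h : X * E -> Y) (l : X -> seq E) :
  polytime h -> polytime l -> polytime (fun x => [seq h (x, e) | e <- l x]).
Proof.
move=> ph pl; apply: polytime_ext
  (polytime_flatmap (polytime_cons ph (polytime_const [::])) pl) => x.
by elim: (l x) => //= e r ->.
Qed.

Lemma polytime_filter X E `{encodable X} `{encodable E} (p : X * E -> bool) (l : X -> seq E) :
  polytime p -> polytime l -> polytime (fun x => [seq e <- l x | p (x, e)]).
Proof.
move=> pp pl; apply: (@polytime_ext _ _ _ _
  (fun x => flatten [seq (if p (x, e) then [:: e] else [::]) | e <- l x])).
  by move=> x; elim: (l x) => //= e r ->; case: (p _).
apply: (polytime_flatmap (h := fun y => if p y then [:: y.2] else [::])) pl.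
apply: polytime_if pp _ (polytime_const _).
by apply: polytime_cons (polytime_const _); exact/polytime_snd/polytime_id.
Qed.

Lemma polytime_flatten X E `{encodable X} `{encodable E} (l : X -> seq (seq E)) :
  polytime l -> polytime (fun x => flatten (l x)).
Proof.
move=> pl; apply: (@polytime_ext _ _ _ _ (fun x => flatten [seq e | e <- l x])).
  by move=> x; rewrite map_id.
apply: (polytime_flatmap (h := snd)) pl; exact/polytime_snd/polytime_id.
Qed.

(** * Reading an instance *)

Fixpoint pos_bits (p : positive) : seq bool :=
  match p with
  | xH => [:: true]
  | xO q => false :: pos_bits q
  | xI q => true :: pos_bits q
  end.

Definition nat_bits (n : nat) : seq bool :=
  if bin_of_nat n is Npos p then pos_bits p else [::].

Lemma encode_natE n : encode_nat n = bword (nat_bits n).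
Proof.
rewrite /encode_nat /nat_bits; case: bin_of_nat => // p.
by elim: p => //= p ->.
Qed.

Definition bit_cons (b : bool) (n : nat) : nat := b + n.*2.

Lemma nat_bitsK n : foldr bit_cons 0 (nat_bits n) = n.
Proof.
rewrite /nat_bits -[RHS](bin_of_natK n); case: bin_of_nat => // p.
elim: p => //= p ->; rewrite /bit_cons /= ?add0n ?add1n; first by rewrite NatTrec.doubleE.
by rewrite NatTrec.doubleE.
Qed.

Lemma nat_bits_cons b n :
  nat_bits (bit_cons b n) = if ~~ b && (n == 0) then [::] else b :: nat_bits n.
Proof.
rewrite -{1 2}(bin_of_natK n) /nat_bits; case: (bin_of_nat n) => [|p].
  by case: b.
have -> : (nat_of_bin (Npos p) == 0) = false.
  by apply: negbTE; elim: p => //= p; rewrite NatTrec.doubleE; lia.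
rewrite andbF.
have -> : bit_cons b (nat_of_bin (Npos p)) = nat_of_bin (Npos (if b then xI p else xO p)).
  by case: b; rewrite /bit_cons /= NatTrec.doubleE.
by rewrite nat_of_binK; case: b.
Qed.

Lemma nat_bits_inj : injective nat_bits.
Proof. exact: can_inj nat_bitsK. Qed.

Lemma nat_tree_inj : injective (fun n => code (nat_bits n)).
Proof. exact: inj_comp code_inj nat_bits_inj. Qed.

(** Binary digits, as in the input words: with a unary code an atom could be exponentially larger
    than its name. *)
#[export] Instance nat_encodable : encodable nat := Encodable nat_tree_inj.

Lemma letter_tree_inj : injective (fun a => code (nseq (letter_code a) true)).
Proof.
move=> a b /(@code_inj (seq bool)) /(congr1 size); rewrite !size_nseq => /ord_inj.
exact: (can_inj letter_codeK).
Qed.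

#[export] Instance letter_encodable : encodable letter := Encodable letter_tree_inj.

Lemma polytime_bit_cons X `{encodable X} (b : X -> bool) (n : X -> nat) :
  polytime b -> polytime n -> polytime (fun x => bit_cons (b x) (n x)).
Proof.
move=> pb pn; have := computes_if (polytime_andb (polytime_negb pb)
  (polytime_eq pn (polytime_const 0))) (computes_const _ Leaf) (computes_node pb pn).
move=> c; apply: computes_ext c => x.
by rewrite /= nat_bits_cons; case: (_ && _).
Qed.

Lemma csize_bit_cons b n : csize (bit_cons b n) <= csize n + 4.
Proof.
have -> : csize (bit_cons b n) = csize (nat_bits (bit_cons b n)) by [].
have -> : csize n = csize (nat_bits n) by [].
rewrite nat_bits_cons; case: (_ && _); first by rewrite addn4.
by rewrite csize_cons addnC ltn_add2l; case: b.
Qed.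

Definition form_state : Type := seq (seq (seq (seq literal)) * seq (seq literal)) *
  (seq (seq (seq literal)) * seq (seq literal)).

Definition atom0 : literal := (0, true).

(* Meant for clauses and conjunctions of literals only: [Neg] makes the first
   literal negative, so that the result is never longer than the formula. *)
Fixpoint literals (f : formula) : seq literal :=
  match f with
  | Var p => [:: (p, true)]
  | Bot | Top => [::]
  | Neg g => ((head atom0 (literals g)).1, false) :: behead (literals g)
  | And g h | Or g h | Imp g h => literals g ++ literals h
  end.

(** Read from right to left, Polish notation is evaluated on a stack: the arguments of a connective
    are the first entries of [fs]. [EndAtom] opens an atom with value 0, into which the digits are
    shifted, the most significant one coming first. *)
Definition read_form (fs : seq (seq literal)) (a : letter) : seq (seq literal) :=
  let f := head [::] fs in
  let l := head atom0 f in
  let merged := (f ++ head [::] (behead fs)) :: behead (behead fs) in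
  let neg := ((l.1, false) :: behead f) :: behead fs in
  let bit b := ((bit_cons b l.1, l.2) :: behead f) :: behead fs in
  if a == Bit true then bit true else
  if a == Bit false then bit false else
  if a == EndAtom then [:: atom0] :: fs else
  if a == LNeg then neg else
  if (a == LBot) || (a == LTop) then [::] :: fs else merged.

(* Words are read from right to left. A state consists of the lists already
   closed, each with the formulas which precede it, of the items of the current
   list, and of the formulas of the current item. *)
Definition read_letter (st : form_state) (a : letter) : form_state :=
  if a == Item then (st.1, (st.2.2 :: st.2.1, [::])) else
  if a == EndList then (st.2 :: st.1, ([::], [::])) else
  (st.1, (st.2.1, read_form st.2.2 a)).

Definition parse_word (w : seq letter) : form_state :=
  foldr (fun a st => read_letter st a) ([::], ([::], [::])) w.

Definition read_word st w := foldr (fun a st => read_letter st a) st w.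

Lemma read_cat st w1 w2 : read_word st (w1 ++ w2) = read_word (read_word st w2) w1.
Proof. exact: foldr_cat. Qed.

Lemma read_encode_form st f :
  read_word st (encode_form f) = (st.1, (st.2.1, literals f :: st.2.2)).
Proof.
elim: f st => /= [p|||f IH|f IHf g IHg|f IHf g IHg|f IHf g IHg] [ls [its fs]] //.
- rewrite -cats1 read_cat encode_natE /=.
  rewrite /read_letter /= /read_form /=.
  suff -> : forall v n, read_word (ls, (its, [:: (n, true)] :: fs)) (bword v) =
    (ls, (its, [:: (foldr bit_cons n v, true)] :: fs)) by rewrite nat_bitsK.
  by elim=> // b v IH n; rewrite /= IH /read_letter /= /read_form; case: b.
- by rewrite IH.
- by rewrite read_cat IHg IHf.
- by rewrite read_cat IHg IHf.
- by rewrite read_cat IHg IHf.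
Qed.

Definition item_of_default (d : default) : seq (seq literal) :=
  [:: literals (prereq d); literals (justif d); literals (concl d)].

Lemma read_encode_default st d :
  read_word st (encode_default d) = (st.1, (st.2.1, item_of_default d ++ st.2.2)).
Proof. by rewrite /encode_default !read_cat !read_encode_form. Qed.

Lemma read_encode_pair st p :
  read_word st (encode_pair p) =
  (st.1, (st.2.1, (item_of_default p.1 ++ item_of_default p.2) ++ st.2.2)).
Proof. by rewrite /encode_pair read_cat !read_encode_default. Qed.

Lemma read_encode_seq T (enc : T -> seq letter) (item : T -> seq (seq literal)) st s :
  (forall st x, read_word st (enc x) = (st.1, (st.2.1, item x ++ st.2.2))) ->
  read_word st (encode_seq enc s) = (st.2 :: st.1, ([seq item x | x <- s], [::])).
Proof.
move=> encE; rewrite /encode_seq -cats1 read_cat.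
have -> : read_word st [:: EndList] = (st.2 :: st.1, ([::], [::])) by [].
by elim: s => //= x s IH; rewrite read_cat IH encE cats0.
Qed.

Lemma parse_encode_instance x :
  parse_word (encode_instance x) =
  ([:: ([seq [:: literals f] | f <- facts x], [::]);
       ([seq item_of_default p.1 ++ item_of_default p.2 | p <- priority x], [::]);
       ([::], [:: literals (lit_form (query x))])],
   ([seq item_of_default d | d <- defaults x], [::])).
Proof.
rewrite /parse_word -/(read_word _ _) /encode_instance !read_cat read_encode_form.
rewrite (read_encode_seq _ _ read_encode_pair).
rewrite (read_encode_seq (item := fun f => [:: literals f]) _ _ read_encode_form).
by rewrite (read_encode_seq _ _ read_encode_default).
Qed.

Ltac polytime_tac :=
  lazymatch goal with
  | |- polytime (fun x => x) => exact: polytime_id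
  | |- polytime fst => exact/polytime_fst/polytime_id
  | |- polytime snd => exact/polytime_snd/polytime_id
  | |- polytime (fun x => (_, _)) => apply: polytime_pair; polytime_tac
  | |- polytime (fun x => _.1) => apply: polytime_fst; polytime_tac
  | |- polytime (fun x => _.2) => apply: polytime_snd; polytime_tac
  | |- polytime (fun x => if _ then _ else _) => apply: polytime_if; polytime_tac
  | |- polytime (fun x => _ && _) => apply: polytime_andb; polytime_tac
  | |- polytime (fun x => _ || _) => apply: polytime_orb; polytime_tac
  | |- polytime (fun x => ~~ _) => apply: polytime_negb; polytime_tac
  | |- polytime (fun x => _ == _) => apply: polytime_eq; polytime_tac
  | |- polytime (fun x => behead _) => apply: polytime_behead; polytime_tac
  | |- polytime (fun x => head _ _) => apply: polytime_head; polytime_tac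
  | |- polytime (fun x => _ ++ _) => apply: polytime_cat; polytime_tac
  | |- polytime (fun x => bit_cons _ _) => apply: polytime_bit_cons; polytime_tac
  | |- polytime (fun x => _ :: _) => apply: polytime_cons; polytime_tac
  | |- polytime (fun x => ?c) => try exact: polytime_const
  | |- _ => idtac
  end.

Lemma polytime_read_form :
  polytime (fun y : seq (seq literal) * letter => read_form y.1 y.2).
Proof. by rewrite /read_form /literal; polytime_tac. Qed.

Lemma polytime_read_letter :
  polytime (fun y : form_state * letter => read_letter y.1 y.2).
Proof.
rewrite /read_letter /form_state /literal; polytime_tac.
apply: (polytime_comp (g := fun y => read_form y.1 y.2)
  (f := fun x => (x.1.2.2, x.2)) polytime_read_form).
by polytime_tac.
Qed.

Lemma csize_nil T `{encodable T} : csize (@nil T) = 1.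
Proof. by []. Qed.

Lemma csize_head_behead T `{encodable T} (x : T) s :
  csize (head x s) + csize (behead s) <= csize s + csize x.
Proof. by case: s => [|y s] /=; rewrite ?csize_cons; lia. Qed.

(** A letter moves lists around without copying them and adds boundedly many nodes; 20 is a generous
    bound. Growth by a constant per letter is what the fold over the input word needs. *)
Lemma csize_read_form fs a : csize (read_form fs a) <= csize fs + 20.
Proof.
rewrite /read_form.
pose proof (csize_head_behead [::] fs) as le1.
pose proof (csize_head_behead atom0 (head [::] fs)) as le2.
pose proof (csize_head_behead [::] (behead fs)) as le3.
set f := head [::] fs in le1 le2 *; set l := head atom0 f in le2 *.
have cl : csize l = (csize l.1 + csize l.2).+1 by case: (l) => *; apply: csize_pair.
have csl : 0 < csize l.2 by case: (l.2).
have ca : csize atom0 = 5 by [].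
have cf : csize false = 1 by [].
have cn : csize 0 = 1 by [].
have ct : csize true = 3 by [].
rewrite csize_nil in le1 le3.
have := csize_bit_cons true l.1; have := csize_bit_cons false l.1.
pose proof (csize_cat f (head [::] (behead fs))).
case: ifP => _; last case: ifP => _; last case: ifP => _; last case: ifP => _;
  last case: ifP => _; rewrite !csize_cons ?csize_pair ?csize_nil; lia.
Qed.

Lemma csize_read_letter st a : csize (read_letter st a) <= csize st + 20.
Proof.
case: st => [ls [its fs]]; rewrite /read_letter /=.
have := csize_read_form fs a.
by case: ifP => _; last case: ifP => _; rewrite !csize_pair ?csize_cons ?csize_pair /=;
  rewrite ?csize_nil; lia.
Qed.

(* The machine reads its input from left to right onto a stack. *)
Lemma polytime_parse : polytime (fun w : seq letter => parse_word (rev w)).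
Proof.
apply: (@polytime_ext _ _ _ _ (fun w => foldl (fun st a => read_letter st a)
  ([::], ([::], [::])) w)).
  by move=> w; rewrite /parse_word -foldl_rev revK.
apply: (@polytime_foldl_incr _ _ _ _ _ _ (fun y => read_letter y.1.2 y.2) _ _ 5).
- apply: (polytime_comp (g := fun y => read_letter y.1 y.2)
    (f := fun x => (x.1.2, x.2)) polytime_read_letter).
  by polytime_tac.
- exact: polytime_id.
- exact: polytime_const.
- move=> x s e /=; apply: leq_trans (csize_read_letter _ _) _; rewrite leq_add2l.
  by apply: (@leq_trans (2 ^ 5)) => //; rewrite leq_exp2r // leq_addl.
Qed.

(** * The decision procedure *)

Definition clause : Type := seq literal.
Definition cnf : Type := seq clause.

Definition lneg (l : literal) : literal := (l.1, ~~ l.2).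

Definition forced (K C : seq literal) (l : literal) : bool :=
  all (fun l' => (l' == l) || (lneg l' \in K)) C.

(** The literals of [K] are not carried over. Starting from the empty list, monotonicity makes each
    round contain the previous one anyway, while every round stays no larger than [flatten F]. *)
Definition propagate (F : cnf) (K : seq literal) : seq literal :=
  flatten [seq [seq l <- C | forced K C l] | C <- F].

Definition saturation (F : cnf) : seq literal :=
  foldl (fun K _ => propagate F K) [::] (flatten F).

(** The empty clause needs its own test, since it forces no literal. *)
Definition refuted (F : cnf) : bool :=
  ([::] \in F) || has (fun l => lneg l \in saturation F) (saturation F).

(* Unit propagation from [F] alone decides Horn sets; for 2-literal sets one must
   also branch on a single literal. Doing the latter in both cases is sound and
   complete, and spares a case distinction. [atom0] makes the range nonempty. *)
Definition unsat (F : cnf) : bool :=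
  has (fun l => refuted ([:: l] :: F) && refuted ([:: lneg l] :: F))
    (atom0 :: flatten F).

Definition add_units (ls : seq literal) (F : cnf) : cnf :=
  [seq [:: l] | l <- ls] ++ F.

Definition proves (F : cnf) (ls : seq literal) : bool :=
  all (fun l => unsat ([:: lneg l] :: F)) ls.

(* A default is represented by the literals of its prerequisite, justification
   and conclusion, a pair of defaults by the concatenation of both items. *)
Notation item := (seq (seq literal)).

Definition item_prereq (d : item) : seq literal := head [::] d.
Definition item_justif (d : item) : seq literal := head [::] (behead d).
Definition item_concl (d : item) : seq literal := head [::] (behead (behead d)).

Definition with_concls (F : cnf) (L : seq item) : cnf :=
  add_units (flatten [seq item_concl d | d <- L]) F.

Definition item_active (F : cnf) (L : seq item) (d : item) : bool :=
  [&& proves (with_concls F L) (item_prereq d),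
      ~~ unsat (add_units (item_justif d) (with_concls F L))
    & ~~ proves (with_concls F L) (item_concl d)].

Definition next_items (F : cnf) (D P : seq item) (L : seq item) : seq item :=
  [seq d <- D | item_active F L d &&
     ~~ has (fun d' => (d' ++ d \in P) && item_active F L d') D].

Definition greedy_items (F : cnf) (D P : seq item) : seq item :=
  foldl (fun L _ => L ++ next_items F D P L) [::] D.

(** The implication covers the case without extensions, in which every literal is accepted. *)
Definition accepts (F : cnf) (D P : seq item) (l : literal) : bool :=
  let L := greedy_items F D P in
  all (fun d => ~~ unsat (add_units (item_justif d) (with_concls F L))) L ==>
  proves (with_concls F L) [:: l].

(** * Running time of the decision procedure *)

Lemma polytime_lneg X `{encodable X} (l : X -> literal) :
  polytime l -> polytime (fun x => lneg (l x)).
Proof. by rewrite /literal /lneg => pl; polytime_tac. Qed.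

Lemma polytime_forced X `{encodable X} (K C : X -> seq literal) l :
  polytime K -> polytime C -> polytime l ->
  polytime (fun x => forced (K x) (C x) (l x)).
Proof.
move=> pK pC pl.
apply: (polytime_all (p := fun y => (y.2 == l y.1) || (lneg y.2 \in K y.1))) pC.
apply: polytime_orb.
  apply: polytime_eq; first by polytime_tac.
  by apply: (polytime_comp pl); polytime_tac.
apply: polytime_mem; first by apply: polytime_lneg; rewrite /literal; polytime_tac.
by apply: (polytime_comp pK); polytime_tac.
Qed.

Lemma polytime_propagate X `{encodable X} (F : X -> cnf) K :
  polytime F -> polytime K -> polytime (fun x => propagate (F x) (K x)).
Proof.
move=> pF pK.
apply: (polytime_flatmap (h := fun y => [seq l <- y.2 | forced (K y.1) y.2 l])) pF.
apply: (polytime_filter (p := fun z => forced (K z.1.1) z.1.2 z.2)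
  (l := fun y => y.2)); last by rewrite /literal; polytime_tac.
apply: polytime_forced; rewrite /clause /literal; polytime_tac.
by apply: (polytime_comp pK); polytime_tac.
Qed.

Lemma csize_filter T `{encodable T} p (s : seq T) : csize (filter p s) <= csize s.
Proof.
elim: s => //= x s IH; case: (p x); rewrite !csize_cons; lia.
Qed.

Lemma csize_propagate F K : csize (propagate F K) <= csize (flatten F).
Proof.
rewrite /propagate; elim: F => //= C F IH.
by rewrite -ltnS !csize_cat leq_add // csize_filter.
Qed.

Lemma polytime_saturation X `{encodable X} (F : X -> cnf) :
  polytime F -> polytime (fun x => saturation (F x)).
Proof.
move=> pF; apply: (polytime_comp (g := saturation)) pF => {F}.
have pf : polytime (fun F : cnf => flatten F).
  by apply: polytime_flatten; apply: polytime_id.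
have [k kE] := polytime_size pf.
apply: (@polytime_foldl_incr _ _ _ _ _ _ (fun y => propagate y.1.1 y.1.2) _ _ k) => //.
- by apply: polytime_propagate; rewrite /cnf /clause /literal; polytime_tac.
- exact: polytime_const.
move=> F K l /=; apply: leq_trans (csize_propagate F K) _.
apply: leq_trans (kE F) _; apply: leq_trans (leq_addl _ _).
by case: (k) => // k'; rewrite leq_exp2r //; lia.
Qed.

Lemma polytime_refuted X `{encodable X} (F : X -> cnf) :
  polytime F -> polytime (fun x => refuted (F x)).
Proof.
move=> pF; apply: polytime_orb.
  by apply: polytime_mem pF; apply: polytime_const.
have pc := polytime_saturation pF.
apply: (polytime_has (p := fun y => lneg y.2 \in saturation (F y.1))) pc.
apply: polytime_mem; first by apply: polytime_lneg; rewrite /literal; polytime_tac.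
by apply: polytime_saturation; apply: (polytime_comp pF); polytime_tac.
Qed.

Lemma polytime_unsat X `{encodable X} (F : X -> cnf) :
  polytime F -> polytime (fun x => unsat (F x)).
Proof.
move=> pF; apply: (polytime_has (p := fun y => refuted ([:: y.2] :: F y.1) &&
  refuted ([:: lneg y.2] :: F y.1))); last first.
  apply: polytime_cons (polytime_const _) _; exact: polytime_flatten.
have pF1 E (eE : encodable E) : polytime (fun y : X * E => F y.1).
  by apply: (polytime_comp pF); polytime_tac.
apply: polytime_andb; apply: polytime_refuted; apply: polytime_cons => //;
  apply: polytime_cons; rewrite /clause; try exact: polytime_const.
- by rewrite /literal; polytime_tac.
- by apply: polytime_lneg; rewrite /literal; polytime_tac.
Qed.

Lemma polytime_add_units X `{encodable X} (F : X -> cnf) ls :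
  polytime F -> polytime ls -> polytime (fun x => add_units (ls x) (F x)).
Proof.
move=> pF pls; apply: polytime_cat pF.
by apply: (polytime_map (h := fun y => [:: y.2])) pls; rewrite /literal; polytime_tac.
Qed.

Lemma polytime_proves X `{encodable X} (F : X -> cnf) ls :
  polytime F -> polytime ls -> polytime (fun x => proves (F x) (ls x)).
Proof.
move=> pF pls; apply: (polytime_all (p := fun y => unsat ([:: lneg y.2] :: F y.1))) pls.
apply: polytime_unsat; apply: polytime_cons.
  by apply: polytime_cons (polytime_const _); apply: polytime_lneg; rewrite /literal; polytime_tac.
by apply: (polytime_comp pF); polytime_tac.
Qed.

Lemma polytime_with_concls X `{encodable X} (F : X -> cnf) (L : X -> seq item) :
  polytime F -> polytime L -> polytime (fun x => with_concls (F x) (L x)).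
Proof.
move=> pF pL; apply: polytime_add_units pF _; apply: polytime_flatten.
apply: (polytime_map (h := fun y => item_concl y.2)) pL.
by rewrite /item_concl /literal; polytime_tac.
Qed.

Lemma polytime_item_active X `{encodable X} (F : X -> cnf) (L : X -> seq item) d :
  polytime F -> polytime L -> polytime d ->
  polytime (fun x => item_active (F x) (L x) (d x)).
Proof.
move=> pF pL pd; have pFL := polytime_with_concls pF pL.
apply: polytime_andb; last apply: polytime_andb; try apply: polytime_negb.
- by apply: polytime_proves pFL _; rewrite /item_prereq; polytime_tac.
- apply/polytime_unsat/polytime_add_units => //; rewrite /item_justif; polytime_tac.
  exact: pd.
- by apply: polytime_proves pFL _; rewrite /item_concl; polytime_tac.
Qed.

Lemma polytime_next_items X `{encodable X} (F : X -> cnf) (D P L : X -> seq item) :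
  polytime F -> polytime D -> polytime P -> polytime L ->
  polytime (fun x => next_items (F x) (D x) (P x) (L x)).
Proof.
move=> pF pD pP pL.
apply: (polytime_filter (p := fun y => item_active (F y.1) (L y.1) y.2 &&
   ~~ has (fun d' => (d' ++ y.2 \in P y.1) && item_active (F y.1) (L y.1) d') (D y.1))) (pD).
have p1 E (eE : encodable E) Y (eY : encodable Y) (f : X -> Y) :
    polytime f -> polytime (fun y : X * E => f y.1).
  by move=> pf; apply: (polytime_comp pf); polytime_tac.
apply: polytime_andb.
  by apply: polytime_item_active; try (by apply: p1); rewrite /literal; polytime_tac.
apply: polytime_negb.
apply: (polytime_has (p := fun z => (z.2 ++ z.1.2 \in P z.1.1) &&
  item_active (F z.1.1) (L z.1.1) z.2)); last exact: p1.
have p2 E (eE : encodable E) E' (eE' : encodable E') Y (eY : encodable Y) (f : X -> Y) :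
    polytime f -> polytime (fun y : X * E * E' => f y.1.1).
  by move=> pf; apply: (polytime_comp pf); polytime_tac.
apply: polytime_andb.
  apply: polytime_mem; last exact: p2.
  by rewrite /literal; polytime_tac.
by apply: polytime_item_active; try (by apply: p2); rewrite /literal; polytime_tac.
Qed.

(** Each round appends a sublist of [D], which bounds the growth independently of [L]. *)
Lemma polytime_greedy_items X `{encodable X} (F : X -> cnf) (D P : X -> seq item) :
  polytime F -> polytime D -> polytime P ->
  polytime (fun x => greedy_items (F x) (D x) (P x)).
Proof.
move=> pF pD pP; have [k kE] := polytime_size pD.
apply: (@polytime_foldl_incr _ _ _ _ _ _
  (fun y => y.1.2 ++ next_items (F y.1.1) (D y.1.1) (P y.1.1) y.1.2) _ _ k) => //.
- apply: polytime_cat; first by rewrite /literal; polytime_tac.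
  apply: polytime_next_items; last by rewrite /literal; polytime_tac.
  + by apply: (polytime_comp pF); polytime_tac.
  + by apply: (polytime_comp pD); polytime_tac.
  + by apply: (polytime_comp pP); polytime_tac.
- exact: polytime_const.
move=> x L d /=; pose proof (csize_cat L (next_items (F x) (D x) (P x) L)).
have le1 : csize (next_items (F x) (D x) (P x) L) <= (csize x + csize d + 2) ^ k.
  apply: leq_trans (csize_filter _ _) _; apply: leq_trans (kE x) _.
  by case: (k) => // k'; rewrite leq_exp2r //; lia.
by lia.
Qed.

Lemma polytime_accepts X `{encodable X} (F : X -> cnf) (D P : X -> seq item) l :
  polytime F -> polytime D -> polytime P -> polytime l ->
  polytime (fun x => accepts (F x) (D x) (P x) (l x)).
Proof.
move=> pF pD pP pl; rewrite /accepts.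
have pG := polytime_greedy_items pF pD pP.
have pFG := polytime_with_concls pF pG.
apply: (@polytime_ext _ _ _ _ (fun x =>
  ~~ all (fun d => ~~ unsat (add_units (item_justif d)
       (with_concls (F x) (greedy_items (F x) (D x) (P x)))))
     (greedy_items (F x) (D x) (P x)) ||
  proves (with_concls (F x) (greedy_items (F x) (D x) (P x))) [:: l x])).
  by move=> x; rewrite implybE.
apply: polytime_orb; last first.
  by apply: polytime_proves => //; apply: polytime_cons pl (polytime_const _).
apply: polytime_negb; apply: (polytime_all (p := fun y => ~~ unsat
  (add_units (item_justif y.2) (with_concls (F y.1) (greedy_items (F y.1) (D y.1) (P y.1)))))) pG.
apply/polytime_negb/polytime_unsat/polytime_add_units.
  by apply: (polytime_comp pFG); polytime_tac.
by rewrite /item_justif /literal; polytime_tac.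
Qed.

(** The defaults come first in the word, so their list is still open when reading ends and is found
    in [st.2]. The query is a bare formula without [Item], hence [query.2]. *)
Definition decide_parsed (st : form_state) : bool :=
  let facts := head ([::], [::]) st.1 in
  let prio := head ([::], [::]) (behead st.1) in
  let query := head ([::], [::]) (behead (behead st.1)) in
  accepts (flatten facts.1) st.2.1 prio.1 (head atom0 (head [::] query.2)).

Lemma polytime_decide : polytime decide_parsed.
Proof.
apply: polytime_accepts; first apply: polytime_flatten;
  by rewrite /form_state /literal; polytime_tac.
Qed.

(** * Horn and 2-literal clauses *)

Definition lit_true (v : nat -> bool) (l : literal) : bool := v l.1 == l.2.

Definition clause_true (v : nat -> bool) (C : clause) : bool := has (lit_true v) C.

Definition cnf_true (v : nat -> bool) (F : cnf) : bool := all (clause_true v) F.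

Lemma lit_true_neg v l : lit_true v (lneg l) = ~~ lit_true v l.
Proof. by case: l => p b; rewrite /lit_true /=; case: (v p); case: b. Qed.

Definition saturated (F : cnf) (K : seq literal) : Prop :=
  forall C l, C \in F -> l \in C -> forced K C l -> l \in K.

Definition consistent (K : seq literal) : Prop :=
  forall l, l \in K -> lneg l \notin K.

Lemma mem_propagate F K l :
  reflect (exists2 C, C \in F & l \in C /\ forced K C l) (l \in propagate F K).
Proof.
apply: (iffP flattenP) => [[s /mapP [C CF ->]]|[C CF [lC fl]]].
  by rewrite mem_filter => /andP [fl lC]; exists C.
by exists [seq l <- C | forced K C l]; [apply: map_f | rewrite mem_filter fl].
Qed.

Lemma forced_mono K K' C l : {subset K <= K'} -> forced K C l -> forced K' C l.
Proof.
move=> sub; apply: sub_all => l' /orP [->//|/sub ->].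
by rewrite orbT.
Qed.

Lemma propagate_mono F K K' :
  {subset K <= K'} -> {subset propagate F K <= propagate F K'}.
Proof.
move=> sub l /mem_propagate [C CF [lC fl]]; apply/mem_propagate.
by exists C => //; split=> //; apply: forced_mono fl.
Qed.

Lemma count_ltn T (a b : pred T) s :
  subpred a b -> has (predD b a) s -> count a s < count b s.
Proof.
move=> ab; elim: s => //= x s IH /orP [/andP [/= /negbTE nax bx]|/IH lt].
  by rewrite nax bx add0n add1n ltnS sub_count.
by rewrite -addnS leq_add //; case: (a x) (ab x) => // /(_ isT) ->.
Qed.

Lemma saturationE F : saturation F = iter (size (flatten F)) (propagate F) [::].
Proof.
rewrite /saturation; elim: (flatten F) [::] => //= l s IH K.
by rewrite IH -iterSr.
Qed.

(** A round that is not yet stable puts a new literal of [flatten F] into the set, so that more of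
    its entries are covered. This cannot happen more often than [flatten F] has entries, which is
    the number of rounds. *)
Lemma saturation_saturated F : saturated F (saturation F).
Proof.
pose K i := iter i (propagate F) [::]; pose U := flatten F.
pose c i := count (mem (K i)) U.
have sub_next i : {subset K i <= K i.+1} by elim: i => // i IH; apply: propagate_mono.
have sub_U i l : l \in K i.+1 -> l \in U.
  by case/mem_propagate=> C CF [lC _]; apply/flattenP; exists C.
have c_lt i : {subset K i.+1 <= K i} \/ c i < c i.+1.
  case: (boolP (all (mem (K i)) (K i.+1))) => [/allP|/allPn [l lK nlK]]; first by left.
  right; apply: count_ltn; first exact: sub_next.
  by apply/hasP; exists l; [apply: sub_U lK | rewrite /= nlK].
have stable i : {subset K i.+1 <= K i} \/ i < c i.+1.
  elim: i => [|i [sub|lt_i]].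
  - by case: (c_lt 0) => [|lt0]; [left | right; apply: leq_trans lt0].
  - by left; apply: propagate_mono.
  - by case: (c_lt i.+1) => [|lt]; [left | right; apply: leq_trans lt].
have sub : {subset propagate F (saturation F) <= saturation F}.
  rewrite saturationE -/U; case: (stable (size U)) => // lt.
  by have := leq_trans lt (count_size _ _); rewrite ltnn.
by move=> C l CF lC fl; apply/sub/mem_propagate; exists C.
Qed.

Lemma saturation_true v F : cnf_true v F -> all (lit_true v) (saturation F).
Proof.
move=> /allP vF; rewrite saturationE; elim: (size _) => //= n /allP IH.
apply/allP=> l /mem_propagate [C CF [lC fl]].
have /hasP [l' l'C vl'] := vF C CF.
have := allP fl l' l'C; case/orP=> [/eqP <- //|/IH].
by rewrite lit_true_neg vl'.
Qed.

Lemma refuted_sound v F : refuted F -> ~~ cnf_true v F.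
Proof.
move=> rF; apply/negP=> vF; case/orP: rF => [F0|/hasP [l lK nlK]].
  by have := allP vF _ F0.
have /allP vK := saturation_true vF.
by have := vK _ nlK; rewrite lit_true_neg vK.
Qed.

Lemma unsat_sound v F : unsat F -> ~~ cnf_true v F.
Proof.
case/hasP=> l _ /andP [/(refuted_sound v) r1 /(refuted_sound v) r2].
apply/negP=> vF; move: r1 r2; rewrite /= vF /clause_true /= !orbF !andbT.
by rewrite lit_true_neg => /negbTE ->.
Qed.

Lemma forced_self K l : forced K [:: l] l.
Proof. by rewrite /forced /= eqxx. Qed.

Lemma not_refuted_unit F l : ~~ refuted ([:: l] :: F) ->
  [/\ [::] \notin F, saturated F (saturation ([:: l] :: F)),
      consistent (saturation ([:: l] :: F)) & l \in saturation ([:: l] :: F)].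
Proof.
rewrite negb_or => /andP [nF /hasPn cK].
have cl := @saturation_saturated ([:: l] :: F).
split=> //.
- by move=> C l' CF; apply: cl; rewrite inE CF orbT.
- by apply: (cl [:: l]); rewrite ?mem_head ?forced_self.
Qed.

Lemma not_unsat F l : ~~ unsat F -> l \in atom0 :: flatten F ->
  exists2 l', l'.1 = l.1 & exists K,
    [/\ [::] \notin F, saturated F K, consistent K & l' \in K].
Proof.
move=> /hasPn uF /uF; rewrite negb_and => /orP [] /not_refuted_unit nr.
  by exists l => //; exists (saturation ([:: l] :: F)).
by exists (lneg l) => //; exists (saturation ([:: lneg l] :: F)).
Qed.

(** * Models from consistent saturated sets of literals *)

Definition horn (F : cnf) : bool := all (fun C => count snd C <= 1) F.

Definition two_literal (F : cnf) : bool := all (fun C => size C <= 2) F.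

(** Make true exactly the atoms in [K]. In a false clause all negative literals are refuted by [K];
    so a positive literal, if there is one, is forced into [K] and true after all, and otherwise a
    negative literal is forced into [K], against consistency. *)
Lemma horn_model F K : horn F -> [::] \notin F -> saturated F K -> consistent K ->
  exists v, cnf_true v F.
Proof.
move=> /allP hF nF cl con; exists (fun p => (p, true) \in K).
apply/allP=> C CF; apply/negPn/negP=> /hasPn fC.
have neg p : (p, false) \in C -> (p, true) \in K.
  by move/fC; rewrite /lit_true /= eqbF_neg negbK.
have pos p : (p, true) \in C -> (p, true) \notin K.
  by move/fC; rewrite /lit_true /= eqb_id.
have [/hasP [[p []] // lC _]|noP] := boolP (has snd C).
  suff /(cl _ _ CF lC) : forced K C (p, true) by apply/negP/pos.
  apply/allP=> -[q []] qC; last by rewrite /lneg /= neg // orbT.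
  apply/orP; left; apply/negPn/negP=> neq.
  have: size [:: (q, true); (p, true)] <= count snd C.
    rewrite -size_filter; apply: uniq_leq_size; first by rewrite /= inE neq.
    by move=> l; rewrite !inE mem_filter => /orP [] /eqP ->; rewrite /= ?qC ?lC.
  by rewrite ltnNge hF.
case: C CF fC neg pos noP => [|[p b] C] CF fC neg pos noP; first by rewrite CF in nF.
have lC : (p, b) \in (p, b) :: C by rewrite mem_head.
have bE : b = false by apply: negbTE; move: noP; rewrite /= negb_or => /andP [].
rewrite bE in CF lC fC neg pos noP.
have pK : (p, false) \in K.
  apply: (cl _ _ CF lC); apply/allP=> -[q []] qC; last by rewrite /lneg /= neg // orbT.
  by have := hasPn noP _ qC.
by have /negP := con _ pK; apply; apply: neg.
Qed.

(* A consistent saturated set of literals satisfies every 2-literal clause which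
   it touches, so these clauses can be discarded. *)
Lemma two_literal_model F : two_literal F -> [::] \notin F ->
  (forall l, l \in flatten F -> exists2 l', l'.1 = l.1 & exists K,
     [/\ saturated F K, consistent K & l' \in K]) ->
  exists v, cnf_true v F.
Proof.
have [n] := ubnP (size F); elim: n F => // n IH F ltn twoF nF hF.
case: F ltn twoF nF hF => [|[|l0 C0] F]; first by exists xpredT.
  by rewrite mem_head.
set F1 := _ :: F => ltn twoF nF hF.
have l0F : l0 \in flatten F1 by rewrite /= inE eqxx.
have [l l1 [K [cl con lK]]] := hF l0 l0F.
have l0K : (l0 \in K) || (lneg l0 \in K).
  case: l l0 l1 lK {hF l0F F1 ltn twoF nF cl} => p b [q b'] /= -> .
  by rewrite /lneg /=; case: b b' => [] [] ->; rewrite ?orbT.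
have touch C m : C \in F1 -> m \in C -> lneg m \in K -> has (mem K) C.
  move=> CF; have := allP twoF _ CF; have {CF} := cl C _ CF.
  case: C => [|x [|y [|? ?]]] // clC _; rewrite !inE /=.
    by move=> _ _; rewrite clC ?mem_head ?forced_self.
  have xC : x \in [:: x; y] by rewrite mem_head.
  have yC : y \in [:: x; y] by rewrite !inE eqxx orbT.
  case/orP=> /eqP -> nK.
    by rewrite (clC y) ?orbT //= /forced /= nK eqxx !orbT.
  by rewrite (clC x) //= /forced /= nK eqxx !orbT.
pose F2 := [seq C <- F1 | ~~ has (mem K) C].
have sF2 C : C \in F2 -> C \in F1 by rewrite mem_filter => /andP [].
have nF2 C m : C \in F2 -> m \in C -> (m \notin K) && (lneg m \notin K).
  rewrite mem_filter => /andP [nC CF] mC; apply/andP; split.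
    by apply: contra nC => mK; apply/hasP; exists m.
  by apply: contra nC; apply: touch.
have [] := IH F2.
- suff: size F2 < size F1 by move=> lt; apply: leq_trans lt _; rewrite -ltnS.
  rewrite size_filter -(count_predC (fun C => ~~ has (mem K) C)) -[X in X < _]addn0 ltn_add2l.
  rewrite -has_count; apply/hasP; exists (l0 :: C0); rewrite ?mem_head //= negbK.
  by case/orP: l0K => [->//|]; apply: (touch (l0 :: C0)); rewrite mem_head.
- by apply/allP=> C /sF2; apply: (allP twoF).
- by apply: contra nF; apply: sF2.
(* Saturation passes to fewer clauses. This is why the hypothesis allows arbitrary sets [K] in place
   of computed saturations. *)
- move=> m /flattenP [C CF2 mC].
  have mF1 : m \in flatten F1 by apply/flattenP; exists C => //; apply: sF2.
  have [m' m1 [K' [cl' con' mK']]] := hF _ mF1.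
  by exists m' => //; exists K'; split=> // C' l' /sF2; apply: cl'.
(* [K] decides the atoms occurring in it, and [v] all others. *)
move=> v vF2; exists (fun p => ((p, true) \in K) || ((p, false) \notin K) && v p).
have vK l' : l' \in K -> lit_true (fun p => ((p, true) \in K) || ((p, false) \notin K) && v p) l'.
  by case: l' => p [] lK'; rewrite /lit_true /= ?lK' // (negbTE (con _ lK')).
apply/allP=> C CF; have [/hasP [m mC mK]|nC] := boolP (has (mem K) C).
  by apply/hasP; exists m => //; apply: vK.
have CF2 : C \in F2 by rewrite mem_filter nC.
have /hasP [m mC vm] := allP vF2 _ CF2.
apply/hasP; exists m => //; have := nF2 _ _ CF2 mC; move: vm {mC}.
by case: m => p [] /eqP /= vm /andP [];
  rewrite /lit_true /lneg /= => /negbTE -> /negbTE ->; rewrite vm.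
Qed.

Definition tractable (F : cnf) : bool := horn F || two_literal F.

(** Unit clauses belong to both classes, so adding conclusions, justifications or a negated goal to
    the facts preserves tractability. *)
Lemma tractable_unit l F : tractable F -> tractable ([:: l] :: F).
Proof. by case/orP=> tF; apply/orP; [left|right]; rewrite /= tF //; case: l => p []. Qed.

Lemma tractable_add_units ls F : tractable F -> tractable (add_units ls F).
Proof. by move=> tF; elim: ls => //= l ls; apply: tractable_unit. Qed.

Lemma unsatP F : tractable F -> reflect (forall v, ~~ cnf_true v F) (unsat F).
Proof.
move=> tF; apply: (iffP idP) => [uF v|noF]; first exact: unsat_sound.
apply/negPn/negP=> uF.
suff [v vF] : exists v, cnf_true v F by have := noF v; rewrite vF.
case/orP: tF => [hF|twoF].
  have [l _ [K [nF cl con _]]] := not_unsat uF (mem_head _ _).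
  exact: horn_model hF nF cl con.
(* The test at [atom0] excludes the empty clause even if no literal occurs in [F]. *)
have [_ _ [_ [nF _ _ _]]] := not_unsat uF (mem_head _ _).
apply: two_literal_model => // l lF.
have [|l' l'1 [K [_ cl con lK]]] := not_unsat uF (_ : l \in _).
  by rewrite inE lF orbT.
by exists l' => //; exists K.
Qed.

Lemma cnf_true_add_units v ls F :
  cnf_true v (add_units ls F) = all (lit_true v) ls && cnf_true v F.
Proof.
by rewrite /cnf_true all_cat all_map; congr (_ && _); apply: eq_all => l /=; rewrite orbF.
Qed.

Lemma provesP F ls : tractable F ->
  reflect (forall v, cnf_true v F -> all (lit_true v) ls) (proves F ls).
Proof.
move=> tF; apply: (iffP allP) => [pr v vF|pr l lls].
  apply/allP=> l /pr /(unsatP (tractable_unit _ tF)) /(_ v).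
  by rewrite /= vF andbT orbF lit_true_neg negbK.
apply/(unsatP (tractable_unit _ tF)) => v; rewrite /= orbF lit_true_neg.
apply/negP=> /andP [nl vF].
by have := allP (pr v vF) l lls; rewrite (negbTE nl).
Qed.

(** * Formulae and their lists of literals *)

Lemma eval_lit v l : eval v (lit_form l) = lit_true v l.
Proof. by case: l => p []; rewrite /lit_true /=; case: (v p). Qed.

Lemma eval_conjunction v ls : eval v (conjunction ls) = all (lit_true v) ls.
Proof.
elim: ls => //= l [|l' ls] IH; first by rewrite andbT eval_lit.
by rewrite -IH -eval_lit.
Qed.

Lemma eval_disjunction v ls : eval v (disjunction ls) = has (lit_true v) ls.
Proof.
elim: ls => //= l [|l' ls] IH; first by rewrite orbF eval_lit.
by rewrite -IH -eval_lit.
Qed.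

Lemma literals_lit l : literals (lit_form l) = [:: l].
Proof. by case: l => p []. Qed.

Lemma literals_conjunction ls : literals (conjunction ls) = ls.
Proof.
elim: ls => //= l [|l' ls] IH; first exact: literals_lit.
by rewrite -[RHS]cat1s -{2}IH -literals_lit.
Qed.

Lemma literals_disjunction ls : literals (disjunction ls) = ls.
Proof.
elim: ls => //= l [|l' ls] IH; first exact: literals_lit.
by rewrite -[RHS]cat1s -{2}IH -literals_lit.
Qed.

(** * Preferred extensions for a total priority order *)

Local Open Scope classical_set_scope.

Definition implies_all (A B : set formula) : Prop := forall g, B g -> entails A g.

Lemma entails_mem (A : set formula) f : A f -> entails A f.
Proof. by move=> Af v; apply. Qed.

Lemma entails_cut A B f : implies_all A B -> entails B f -> entails A f.
Proof. by move=> AB Bf v vA; apply: Bf => g /AB; apply. Qed.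

Lemma implies_all_sub (A B : set formula) : B `<=` A -> implies_all A B.
Proof. by move=> BA g /BA; apply: entails_mem. Qed.

Lemma implies_all_trans A B C :
  implies_all A B -> implies_all B C -> implies_all A C.
Proof. by move=> AB BC g /BC; apply: entails_cut. Qed.

Lemma implies_allU A B C :
  implies_all A B -> implies_all A C -> implies_all A (B `|` C).
Proof. by move=> AB AC g [/AB|/AC]. Qed.

(** Equality would be too strong an invariant: a stage may contain conclusions that it entailed
    already and that the greedy list does not contribute. *)
Definition equivalent (A B : set formula) : Prop :=
  implies_all A B /\ implies_all B A.

Lemma equivalent_entails A B f : equivalent A B -> entails A f <-> entails B f.
Proof. by case=> AB BA; split; apply: entails_cut. Qed.

Lemma equivalent_active A B d : equivalent A B -> active d A <-> active d B.
Proof.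
by move=> AB; rewrite /active; split=> -[p j c]; split; rewrite ?(equivalent_entails _ AB) //;
  rewrite -?(equivalent_entails _ AB).
Qed.

Section Greedy.

Variables (D : seq default) (W : set formula) (P : rel default).
Variable act : seq default -> pred default.

Definition with_conclusions (L : seq default) : set formula :=
  W `|` [set concl d | d in [set` L]].

Hypothesis actP : forall L d, {subset L <= D} -> d \in D ->
  reflect (active d (with_conclusions L)) (act L d).
Hypothesis P_total : {in D &, forall d d', d != d' -> P d d' || P d' d}.

Definition next_defaults (L : seq default) : seq default :=
  [seq d <- D | act L d && ~~ has (fun d' => P d' d && act L d') D].

Definition greedy (i : nat) : seq default :=
  iter i (fun L => L ++ next_defaults L) [::].

Lemma greedy_sub i : {subset greedy i <= D}.
Proof.
elim: i => //= i IH d; rewrite mem_cat => /orP [/IH //|].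
by rewrite mem_filter => /andP [].
Qed.

Lemma with_conclusions_mono L L' : {subset L <= L'} ->
  implies_all (with_conclusions L') (with_conclusions L).
Proof.
move=> sub; apply: implies_all_sub => g [Wg|[d Ld <-]]; first by left.
by right; exists d => //; apply: sub.
Qed.

Lemma next_defaults_unique L d d' :
  d \in next_defaults L -> d' \in next_defaults L -> d = d'.
Proof.
rewrite !mem_filter => /andP [/andP [ad /hasPn hd] dD] /andP [/andP [ad' /hasPn hd'] d'D].
apply/eqP/negPn/negP=> neq; case/orP: (P_total dD d'D neq) => Pdd.
  by have := hd' _ dD; rewrite Pdd ad.
by have := hd _ d'D; rewrite Pdd ad'.
Qed.

Lemma act_notin L d : {subset L <= D} -> act L d -> d \in D -> d \notin L.
Proof.
move=> LD ad dD; apply/negP=> dL; case: (actP LD dD) ad => // -[_ _ nc] _.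
by apply: nc; apply: entails_mem; right; exists d.
Qed.

(** An active default has a conclusion not yet entailed, so it is not in the list. Hence every round
    that adds anything covers a further entry of [D]. *)
Lemma greedy_stops : next_defaults (greedy (size D)) = [::].
Proof.
pose c i := count (mem (greedy i)) D.
have c_lt i : next_defaults (greedy i) = [::] \/ c i < c i.+1.
  case E: (next_defaults (greedy i)) => [|d s]; first by left.
  have : d \in next_defaults (greedy i) by rewrite E mem_head.
  rewrite mem_filter => /andP [/andP [ad _] dD]; right.
  apply: count_ltn => [d'|].
    by rewrite /= mem_cat => ->.
  apply/hasP; exists d => //; rewrite /= mem_cat E mem_head orbT andbT.
  by apply: act_notin ad dD; apply: greedy_sub.
have stable i : next_defaults (greedy i) = [::] \/ i <= c i.
  elim: i => [|i [nil_i|le_i]]; first by right.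
    by left; rewrite /= nil_i cats0.
  by case: (c_lt i) => [nil_i|lt]; [left; rewrite /= nil_i cats0 | right; apply: leq_ltn_trans lt].
case: (c_lt (size D)) => // lt; case: (stable (size D)) => // le.
by have := leq_trans (leq_ltn_trans le lt) (count_size _ _); rewrite ltnn.
Qed.

Lemma greedy_stable i : size D <= i -> greedy i = greedy (size D).
Proof.
move=> /subnK <-; elim: (i - _) => //= k ->.
by rewrite greedy_stops cats0.
Qed.

Lemma greedy_final_sub i : {subset greedy i <= greedy (size D)}.
Proof.
have [le_i|/ltnW/greedy_stable -> //] := leqP i (size D).
rewrite -(subnK le_i); elim: (_ - i) => //= k IH d /IH.
by rewrite mem_cat => ->.
Qed.

Section Stage.

Variable E : set formula.

Notation stageE := (stage [set` D] W P E).

(** Whatever the stage refutes, [E] refutes too; so the justification cannot be what keeps [d] from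
    being active. *)
Lemma stage_inactive i d :
  (forall f, entails (stageE i) f -> entails E f) ->
  entails (stageE i) (prereq d) -> ~ entails E (Neg (justif d)) ->
  ~ active d (stageE i) -> entails (stageE i) (concl d).
Proof.
move=> sub pd jd nad; apply: contrapT => nc; apply: nad.
by split=> // /sub.
Qed.

(** [L'] is left open to serve both continuations: [L ++ next_defaults L] when the next default may
    fire, and [L] itself when its justification is refuted by [E]. *)
Lemma stage_step_sub i L :
  {subset L <= D} -> equivalent (stageE i) (with_conclusions L) ->
  (forall f, entails (stageE i) f -> entails E f) ->
  forall L', {subset L <= L'} ->
  (forall d, d \in next_defaults L -> ~ entails E (Neg (justif d)) -> d \in L') ->
  implies_all (with_conclusions L') (stageE i.+1).
Proof.
move=> LD eqL sub L' LL' nL'; apply: implies_allU.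
  exact: implies_all_trans (with_conclusions_mono LL') eqL.2.
move=> _ [d [dD pd jd top] <-].
have [ad|nad] := EM (active d (stageE i)); last first.
  apply: entails_cut (implies_all_trans (with_conclusions_mono LL') eqL.2) _.
  exact: stage_inactive.
apply: entails_mem; right; exists d => //; apply: nL' => //.
rewrite mem_filter dD andbT; apply/andP; split.
  by apply/(actP LD dD)/(equivalent_active _ eqL).
apply/hasPn=> d' d'D; apply/negP=> /andP [Pd'd /(actP LD d'D) ad'].
by apply: top; exists d'; split=> //; apply/(equivalent_active _ eqL).
Qed.

Lemma stage_step i L : {subset L <= D} ->
  equivalent (stageE i) (with_conclusions L) ->
  (forall f, entails (stageE i) f -> entails E f) ->
  (forall d, d \in next_defaults L -> ~ entails E (Neg (justif d))) ->
  equivalent (stageE i.+1) (with_conclusions (L ++ next_defaults L)).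
Proof.
move=> LD eqL sub ok; split; last first.
  apply: stage_step_sub LD eqL sub _ _ _ => [d|d dn _]; rewrite mem_cat; first by move=> ->.
  by rewrite dn orbT.
have sub1 : implies_all (stageE i.+1) (stageE i) by apply: implies_all_sub => g; left.
have sub2 := implies_all_trans sub1 eqL.1.
move=> g [Wg|[d]]; first by apply: sub2; left.
rewrite /= mem_cat => /orP [dL|dn] <-; first by apply: sub2; right; exists d.
apply: entails_mem; right; exists d => //.
have jd := ok _ dn; move: dn; rewrite mem_filter => /andP [/andP [ad /hasPn top] dD].
have /(equivalent_active _ eqL) [pd _ _] := elimT (actP LD dD) ad.
split=> // -[d' [d'D Pd'd /(equivalent_active _ eqL)]] /(actP LD d'D) ad'.
by have := top _ d'D; rewrite Pd'd ad'.
Qed.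

(* In this case all further stages are equivalent, hence [E] is equivalent to the
   current one, in which [d] is consistent: a contradiction for extensions. *)
Lemma stage_stuck i L d : {subset L <= D} ->
  equivalent (stageE i) (with_conclusions L) ->
  (forall f, entails (stageE i) f -> entails E f) ->
  d \in next_defaults L -> entails E (Neg (justif d)) ->
  equivalent (stageE i.+1) (with_conclusions L).
Proof.
move=> LD eqL sub dn jd; split; last first.
  by apply: stage_step_sub LD eqL sub _ _ _ => // d' /(next_defaults_unique dn) <-.
apply: implies_all_trans eqL.1; by apply: implies_all_sub => g; left.
Qed.

Lemma stage_mono i j : i <= j -> stageE i `<=` stageE j.
Proof. by move=> /subnK <-; elim: (j - i) => //= k IH f /IH; left. Qed.

End Stage.

Let G := greedy (size D).

Lemma preferred_greedy E : preferred_extension_BH [set` D] W P E ->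
  E = Cn (with_conclusions G) /\
  {in G, forall d, ~ entails E (Neg (justif d))}.
Proof.
move=> prefE; pose st := stage [set` D] W P E.
have EP f : E f <-> exists i, entails (st i) f.
  by rewrite {1}prefE; split=> [[i _ ?]|[i ?]]; exists i.
have sub i f : entails (st i) f -> entails E f.
  by move=> fi; apply/entails_mem/EP; exists i.
have all_i i : equivalent (st i) (with_conclusions (greedy i)) /\
    {in greedy i, forall d, ~ entails E (Neg (justif d))}.
  elim: i => [|i [eqi oki]].
    split=> //; split; apply: implies_all_sub => g; [by case=> // -[d] | by left].
  have okn d : d \in next_defaults (greedy i) -> ~ entails E (Neg (justif d)).
    move=> dn jd.
    have stuck j : equivalent (st (j + i)) (with_conclusions (greedy i)).
      elim: j => // j IH.
      by apply: (stage_stuck (@greedy_sub i) IH _ dn jd); apply: sub.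
    have Ei : implies_all (with_conclusions (greedy i)) E.
      move=> f /EP [k fk]; apply/(equivalent_entails _ (stuck k)).
      apply: entails_cut fk; apply/implies_all_sub/stage_mono; exact: leq_addr.
    move: (dn); rewrite mem_filter => /andP [/andP [ad _] dD].
    have [_ nj _] := elimT (actP (@greedy_sub i) dD) ad.
    by apply: nj; apply: entails_cut jd.
  split; first by apply: (stage_step (@greedy_sub i) eqi _ okn); apply: sub.
  by move=> d; rewrite /= mem_cat => /orP [/oki|/okn].
split; last exact: (all_i (size D)).2.
rewrite predeqE => f; split=> [/EP [i fi]|fG].
  apply: entails_cut (with_conclusions_mono (@greedy_final_sub i)) _.
  by apply/(equivalent_entails _ (all_i i).1).
by apply/EP; exists (size D); apply/(equivalent_entails _ (all_i (size D)).1).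
Qed.

(** Each default added in some round belongs to the final list, so the hypothesis meets the
    condition of [stage_step] in every round and the stages follow the greedy lists. *)
Lemma greedy_preferred :
  {in G, forall d, ~ entails (with_conclusions G) (Neg (justif d))} ->
  preferred_extension_BH [set` D] W P (Cn (with_conclusions G)).
Proof.
move=> ok; set E := Cn _; pose st := stage [set` D] W P E.
have EG f : entails E f <-> entails (with_conclusions G) f.
  by split=> [|fG]; [apply: entails_cut | apply: entails_mem].
have eq_st i : equivalent (st i) (with_conclusions (greedy i)).
  elim: i => [|i IH].
    by split; apply: implies_all_sub => g; [case=> // -[d] | left].
  apply: (stage_step (@greedy_sub i) IH).
    move=> f /(equivalent_entails _ IH) fi; apply/EG.
    exact: entails_cut (with_conclusions_mono (@greedy_final_sub i)) fi.
  move=> d dn /EG; apply: ok; apply: (@greedy_final_sub i.+1).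
  by rewrite /= mem_cat dn orbT.
rewrite /preferred_extension_BH predeqE => f; split=> [fG|[i _ fi]].
  by exists (size D) => //; apply/(equivalent_entails _ (eq_st (size D))).
apply: entails_cut (with_conclusions_mono (@greedy_final_sub i)) _.
by apply/(equivalent_entails _ (eq_st i)).
Qed.

Lemma consequence_greedy f : consequence_BH [set` D] W P f <->
  ({in G, forall d, ~ entails (with_conclusions G) (Neg (justif d))} ->
   entails (with_conclusions G) f).
Proof.
split=> [cf ok|gf E /preferred_greedy [-> ok]].
  exact: cf (greedy_preferred ok).
apply: gf => d /ok nE jd; apply: nE; apply: entails_cut jd.
by move=> g Wg; apply: entails_mem; apply: entails_mem.
Qed.

End Greedy.

(** * Correctness *)

Lemma literals_disjunction_free d : disjunction_free d ->
  d = Default (conjunction (literals (prereq d))) (conjunction (literals (justif d)))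
        (conjunction (literals (concl d))).
Proof. by case=> a [b [c [_ ->]]]; rewrite /= !literals_conjunction. Qed.

(** [literals] forgets the connectives, but a disjunction-free default can be rebuilt from its three
    lists as canonical conjunctions. *)
Lemma item_of_default_inj d d' : disjunction_free d -> disjunction_free d' ->
  item_of_default d = item_of_default d' -> d = d'.
Proof.
move=> /literals_disjunction_free dE /literals_disjunction_free d'E [E1 E2 E3].
by rewrite dE d'E E1 E2 E3.
Qed.

Section Instance.

Variable x : instance.
Hypothesis wf : well_formed x.

Let F : cnf := [seq literals f | f <- facts x].
Let items := [seq item_of_default d | d <- defaults x].
Let prio := [seq item_of_default p.1 ++ item_of_default p.2 | p <- priority x].
Let act L d := item_active F [seq item_of_default d | d <- L] (item_of_default d).

Let df d : d \in defaults x -> disjunction_free d.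
Proof. by case: wf => + _ _; apply. Qed.

Let literals_fact f : f \in facts x -> f = disjunction (literals f).
Proof.
by case: wf => _ [] cl _ /cl [ls _ ->]; rewrite literals_disjunction.
Qed.

Lemma tractable_facts : tractable F.
Proof.
case: wf => _ cl _; apply/orP; case: cl => cl; [left|right];
  apply/allP => _ /mapP [f /cl [ls le_ls ->] ->]; by rewrite literals_disjunction.
Qed.

Let FL L := with_concls F [seq item_of_default d | d <- L].

Lemma tractable_with_concls L : tractable (FL L).
Proof. exact/tractable_add_units/tractable_facts. Qed.

Lemma with_concls_true v L : {subset L <= defaults x} ->
  (forall g, with_conclusions [set` facts x] L g -> eval v g) <-> cnf_true v (FL L).
Proof.
move=> LD; rewrite cnf_true_add_units; split=> [vS|/andP [/allP vL /allP vF] g].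
  apply/andP; split.
    apply/allP=> l /flattenP [_ /mapP [_ /mapP [d dL ->] ->]] lc.
    have: eval v (concl d) by apply: vS; right; exists d.
    rewrite (literals_disjunction_free (df (LD _ dL))) eval_conjunction => /allP.
    exact.
  apply/allP=> _ /mapP [f fx ->].
  have: eval v f by apply: vS; left.
  by rewrite {1}(literals_fact fx) eval_disjunction.
case=> [/= gx|[d dL <-]].
  have := vF _ (map_f literals gx).
  by rewrite {2}(literals_fact gx) eval_disjunction.
rewrite (literals_disjunction_free (df (LD _ dL))) eval_conjunction; apply/allP=> l lc.
apply: vL; apply/flattenP; exists (literals (concl d)) => //.
by apply/mapP; exists (item_of_default d) => //; apply: map_f.
Qed.

Lemma entails_conjunction L ls : {subset L <= defaults x} ->
  reflect (entails (with_conclusions [set` facts x] L) (conjunction ls))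
    (proves (FL L) ls).
Proof.
move=> LD; apply: (iffP (provesP _ (tractable_with_concls L))) => pr v.
  by move/(with_concls_true v LD)/pr; rewrite eval_conjunction.
by move/(with_concls_true v LD)/pr; rewrite eval_conjunction.
Qed.

Lemma entails_neg_conjunction L ls : {subset L <= defaults x} ->
  reflect (entails (with_conclusions [set` facts x] L) (Neg (conjunction ls)))
    (unsat (add_units ls (FL L))).
Proof.
move=> LD.
apply: (iffP (unsatP (tractable_add_units ls (tractable_with_concls L)))) => un v.
  move/(with_concls_true v LD) => vL; have := un v.
  by rewrite cnf_true_add_units vL andbT /= eval_conjunction.
rewrite cnf_true_add_units; apply/negP=> /andP [vls /(with_concls_true v LD)/un].
by rewrite /= eval_conjunction vls.
Qed.

Lemma actP L d : {subset L <= defaults x} -> d \in defaults x ->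
  reflect (active d (with_conclusions [set` facts x] L)) (act L d).
Proof.
move=> LD /df /literals_disjunction_free dE.
have prP := entails_conjunction (literals (prereq d)) LD.
have juP := entails_neg_conjunction (literals (justif d)) LD.
have coP := entails_conjunction (literals (concl d)) LD.
have [E1 E2 E3] : [/\ conjunction (literals (prereq d)) = prereq d,
    conjunction (literals (justif d)) = justif d &
    conjunction (literals (concl d)) = concl d] by rewrite {2 4 6}dE.
rewrite E1 in prP; rewrite E2 in juP; rewrite E3 in coP; apply: (iffP and3P).
  by move=> [/prP ? /juP ? /coP ?].
by move=> [/prP ? ju co]; split=> //; [apply/juP | apply/coP].
Qed.

Let next := next_defaults (defaults x) (higher_priority x) act.
Let G := greedy (defaults x) (higher_priority x) act (size (defaults x)).

(** Priority pairs consist of defaults of the instance, so both sides are disjunction-free and can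
    be recovered from their items. *)
Lemma mem_prio d d' : d \in defaults x -> d' \in defaults x ->
  (item_of_default d ++ item_of_default d' \in prio) = higher_priority x d d'.
Proof.
move=> dD d'D; case: wf => _ _ [PD _ _ _]; apply/mapP/idP => [[[e e'] eP E]|dP].
  have [eD e'D] := PD _ _ eP.
  have [E1 E2] : item_of_default d = item_of_default e /\ item_of_default d' = item_of_default e'.
    (* Each item has exactly three entries, so the concatenation splits uniquely. *)
    by case: E => p1 j1 c1 p2 j2 c2; rewrite /item_of_default p1 j1 c1 p2 j2 c2.
  by rewrite (item_of_default_inj (df dD) (df eD) E1) (item_of_default_inj (df d'D) (df e'D) E2).
by exists (d, d').
Qed.

Lemma next_itemsE L :
  next_items F items prio [seq item_of_default d | d <- L] =
  [seq item_of_default d | d <- next L].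
Proof.
rewrite /next_items filter_map; congr map; apply: eq_in_filter => d dD /=.
congr (_ && ~~ _); rewrite has_map; apply: eq_in_has => d' d'D /=.
by rewrite mem_prio.
Qed.

Lemma greedy_itemsE : greedy_items F items prio = [seq item_of_default d | d <- G].
Proof.
rewrite /greedy_items /G /greedy /items -(size_map item_of_default).
rewrite -[[::]]/(map item_of_default [::]) -/items.
elim: {2 3}items [::] => //= d s IH L.
by rewrite next_itemsE -map_cat IH -iterSr.
Qed.

Lemma accepts_correct :
  accepts F items prio (query x) <-> consequence_instance x.
Proof.
case: (wf) => _ _ [_ _ _ Ptot].
have GD : {subset G <= defaults x} by apply: greedy_sub.
have cG := consequence_greedy actP Ptot (lit_form (query x)).
have qP := entails_conjunction [:: query x] GD.
rewrite /accepts greedy_itemsE -/(FL G) all_map; split=> [/implyP acc|/cG con].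
  apply/cG => ok; apply/qP/acc/allP=> d dG /=; apply/negP.
  move/(entails_neg_conjunction _ GD); rewrite /item_justif /=.
  by have := ok d dG; rewrite {1}(literals_disjunction_free (df (GD _ dG))).
apply/implyP=> /allP ok; apply/qP/con=> d dG nj.
have /negP := ok _ dG; apply; apply/(entails_neg_conjunction _ GD).
by rewrite /item_justif /=; rewrite {1}(literals_disjunction_free (df (GD _ dG))) in nj.
Qed.


End Instance.

Lemma decide_correct x : well_formed x ->
  decide_parsed (parse_word (encode_instance x)) <-> consequence_instance x.
Proof.
move=> wf; rewrite parse_encode_instance /decide_parsed /= literals_lit /=.
rewrite -(accepts_correct wf); suff -> : flatten [seq [:: literals f] | f <- facts x] =
  [seq literals f | f <- facts x] by [].
by elim: (facts x) => //= f s ->.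
Qed.

(** * Loading the input word and assembling the machine *)

Definition load_letter (s : seq letter) : cmd :=
  foldr (fun a c => If RA (pred1 (Some a)) (Pop RA ;; push_bits (true :: bits (code a))) c)
    Skip s.

(** The first bit is the code of the empty list. Each letter is then consed onto the list, so the
    word arrives reversed. *)
Definition load : cmd :=
  Push RM (Bit false) ;; While RA has_letter (load_letter (enum {: letter})).

(** A letter is coded by at most 10 copies of [true], each costing four bits, and one closing
    bit. *)
Lemma csize_letter (a : letter) : csize a <= 41.
Proof. by case: a => [[]|||||||||]. Qed.

Lemma exec_load_letter a w v s : a \in s ->
  exec (load_letter s) (Store (a :: w) (bword v) [::] [::]) (size s + 90)
    (Store w (bword (true :: bits (code a) ++ v)) [::] [::]).
Proof.
elim: s => //= b s IH; rewrite inE; have [->|neq] := eqVneq a b => [_|/= a_s].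
  apply: (@ExecWeaken _ _ _ (1 + 2 * size (true :: bits (code b))).+2).
    apply: ExecThen => /=; first by rewrite /top /= eqxx.
    apply: ExecSeq (ExecPop _ _) _.
    exact: (exec_push_bits (true :: bits (code b)) w v [::] [::]).
  by have := csize_letter b; rewrite -[size (true :: _)]/(csize b).+1; lia.
apply: (@ExecWeaken _ _ _ (size s + 90).+1); last by lia.
apply: ExecElse; last exact: IH.
by rewrite /top /=; apply: contra neq => /eqP [->].
Qed.

Lemma exec_load_letters w u :
  exec (While RA has_letter (load_letter (enum {: letter})))
    (Store w (bword (bits (code u))) [::] [::])
    ((size (enum {: letter}) + 92) * size w + 1)
    (stack (bits (code (rev w ++ u)))).
Proof.
elim: w u => [|a w IH] u; first by rewrite muln0; apply: ExecExit.
set k := size _ + 92 in IH *.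
apply: (@ExecWeaken _ _ _ ((size (enum {: letter}) + 90) + (k * size w + 1)).+2); last first.
  by rewrite /k /= mulnS; lia.
rewrite rev_cons cat_rcons; apply: ExecLoop (IH (a :: u)) => //.
exact: (@exec_load_letter a w (bits (code u)) _ (mem_enum _ _)).
Qed.

Lemma exec_load w :
  exec load (Store w [::] [::] [::]) ((size (enum {: letter}) + 92) * size w + 3)
    (stack (bits (code (rev w)))).
Proof.
apply: (@ExecWeaken _ _ _ (2 + ((size (enum {: letter}) + 92) * size w + 1))); last by lia.
apply: ExecSeq (ExecPush _ _ _) _ => /=.
by have := exec_load_letters w [::]; rewrite cats0.
Qed.

Lemma csize_word (w : seq letter) : csize w <= 42 * size w + 1.
Proof.
by elim: w => // a w IH; rewrite csize_cons /=; have := csize_letter a; lia.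
Qed.

Lemma horner_pow2 k n : horner (('X + 2%:P) ^+ k : {poly nat})%R n = (n + 2) ^ k.
Proof. by rewrite horner_exp hornerD hornerX hornerC. Qed.

Theorem corollary4p9 :
  polytime_decidable encode_instance well_formed consequence_instance.
Proof.
have [c [k cE]] : polytime (fun u => decide_parsed (parse_word (rev u))).
  exact: polytime_comp polytime_decide polytime_parse.
set N := size (enum {: letter}) + 92.
(* Loading takes N * n + 3 steps and the final test one more; 42 * n + 1 bounds the size of the
   loaded word. *)
have [j jE] : poly_bounded (fun n => N * n + 4 + (42 * n + 1 + 2) ^ k).
  by poly_bounded_tac.
exists (decider (load ;; c) (is_bit true)), (('X + 2%:P) ^+ j)%R => x wf.
set w := encode_instance x; rewrite horner_pow2.
have e : exec (load ;; c) (Store w [::] [::] [::])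
    (N * size w + 3 + (42 * size w + 1 + 2) ^ k)
    (stack (bits (code (decide_parsed (parse_word w))))).
  have := cE (rev w) [::]; rewrite revK !cats0 => e.
  apply: ExecSeq (exec_load w) _; apply: ExecWeaken e _; case: (k) => // m.
  by rewrite leq_exp2r // leq_add2r -(size_rev w); apply: csize_word.
have lt : N * size w + 3 + (42 * size w + 1 + 2) ^ k < (size w + 2) ^ j.
  by apply: leq_trans (jE _); rewrite -addSn -addnS.
have [h acc] := decider_correct (is_bit true) e lt.
split=> //; rewrite acc -(decide_correct wf) -/w.
by case: (decide_parsed _).
Qed.
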